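(* The following is provable in $\mathsf{RCA}_0$: every closed interval order is a distinguishing interval order.
   Context: $\mathsf{RCA}_0$ is the base subsystem of second-order arithmetic ($\Delta^0_1$ comprehension, $\Sigma^0_1$ induction). A partial order $\mathbf{P}=(P,\leq_P)$ is a set $P\subseteq\mathbb{N}$ with a reflexive, transitive, antisymmetric relation; a linear order has any two elements comparable; $p<_P q$ means $p\leq_P q$, $p\ne q$. $\mathbf{P}$ is a closed interval order if there are a linear order $\mathbf{L}=(L,\leq_L)$ and functions $f_0,f_1:P\to L$ with (c1) $f_0(p)\leq_L f_1(p)$ for all $p$ and (c2) $p<_P q$ iff $f_1(p)<_L f_0(q)$ for all $p,q$. It is a distinguishing interval order if there are such $\mathbf{L},f_0,f_1$ satisfying (c1),(c2) and (c4) $f_i(p)\ne f_j(q)$ whenever $p\ne q$ or $i\ne j$ ($i,j\in\{0,1\}$). *)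

(* Defs.v *)
From Stdlib Require Import List.
Import ListNotations.

(** * The language of second-order arithmetic

    De Bruijn indices, with one index space for number variables and a separate
    one for set variables: a number quantifier does not shift set indices, and a
    set quantifier does not shift number indices. *)

Inductive term : Type :=
| tvar (n : nat)
| tzero
| tone
| tadd (s t : term)
| tmul (s t : term).

Inductive form : Type :=
| EqNum (s t : term)
| LtNum (s t : term)
| MemSet (t : term) (X : nat)
| Bot
| Imp (a b : form)
| AllNum (a : form)
| AllSet (a : form).

Definition Neg (a : form) : form := Imp a Bot.
Definition And (a b : form) : form := Neg (Imp a (Neg b)).
Definition Or (a b : form) : form := Imp (Neg a) b.
Definition Iff (a b : form) : form := And (Imp a b) (Imp b a).
Definition ExNum (a : form) : form := Neg (AllNum (Neg a)).
Definition ExSet (a : form) : form := Neg (AllSet (Neg a)).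

Declare Scope term_scope.
Declare Scope form_scope.
Delimit Scope term_scope with term.
Delimit Scope form_scope with form.
Bind Scope term_scope with term.
Bind Scope form_scope with form.

Notation "# n" := (tvar n) (at level 1, format "# n") : term_scope.
Notation "0" := tzero : term_scope.
Notation "1" := tone : term_scope.
Infix "+" := tadd : term_scope.
Infix "*" := tmul : term_scope.

Infix "=" := EqNum : form_scope.
Infix "<" := LtNum : form_scope.
Infix "\in" := MemSet (at level 70, no associativity) : form_scope.
Notation "~ a" := (Neg a) : form_scope.
Infix "/\" := And : form_scope.
Infix "\/" := Or : form_scope.
Infix "->" := Imp : form_scope.
Infix "<->" := Iff : form_scope.

Local Open Scope form_scope.

(** ** Substitution *)

Definition scons {A : Type} (a : A) (s : nat -> A) (n : nat) : A :=
  match n with O => a | S n => s n end.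

Fixpoint tsubst (s : nat -> term) (t : term) : term :=
  match t with
  | tvar n => s n
  | tzero => tzero
  | tone => tone
  | tadd t u => tadd (tsubst s t) (tsubst s u)
  | tmul t u => tmul (tsubst s t) (tsubst s u)
  end.

Definition tshift : term -> term := tsubst (fun n => tvar (S n)).

(* [s] acts on number variables and [r] on set variables; set terms are just
   set variables. *)
Fixpoint subst (s : nat -> term) (r : nat -> nat) (a : form) : form :=
  match a with
  | EqNum t u => EqNum (tsubst s t) (tsubst s u)
  | LtNum t u => LtNum (tsubst s t) (tsubst s u)
  | MemSet t X => MemSet (tsubst s t) (r X)
  | Bot => Bot
  | Imp a b => Imp (subst s r a) (subst s r b)
  | AllNum a => AllNum (subst (scons (tvar O) (fun n => tshift (s n))) r a)
  | AllSet a => AllSet (subst s (scons O (fun n => S (r n))) a)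
  end.

Definition shiftN : form -> form := subst (fun n => tvar (S n)) (fun X => X).
Definition shiftS : form -> form := subst tvar S.
Definition instN (t : term) : form -> form :=
  subst (scons t tvar) (fun X => X).
Definition instS (Y : nat) : form -> form :=
  subst tvar (scons Y (fun X => X)).

(** ** Classical two-sorted natural deduction with equality on numbers

    The members of [T] may be applied in any context, so that their free
    variables are read as universally quantified. *)

Inductive proves (T : form -> Prop) : list form -> form -> Prop :=
| pr_ax G a : T a -> proves T G a
| pr_hyp G a : In a G -> proves T G a
| pr_impI G a b : proves T (a :: G) b -> proves T G (a -> b)
| pr_impE G a b : proves T G (a -> b) -> proves T G a -> proves T G b
| pr_contra G a : proves T ((~ a) :: G) Bot -> proves T G a
| pr_allNI G a : proves T (map shiftN G) a -> proves T G (AllNum a)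
| pr_allNE G a t : proves T G (AllNum a) -> proves T G (instN t a)
| pr_allSI G a : proves T (map shiftS G) a -> proves T G (AllSet a)
| pr_allSE G a Y : proves T G (AllSet a) -> proves T G (instS Y a)
| pr_eq_refl G t : proves T G (t = t)
| pr_eq_subst G t u a :
    proves T G (t = u) -> proves T G (instN t a) -> proves T G (instN u a).

Definition provable (T : form -> Prop) (a : form) : Prop := proves T [] a.

(** * The axioms of RCA0 *)

(* The bound lives outside the quantifier, hence the shift. *)
Definition BAllNum (t : term) (a : form) : form := AllNum (#0 < tshift t -> a).
Definition BExNum (t : term) (a : form) : form := ExNum (#0 < tshift t /\ a).

Inductive Delta00 : form -> Prop :=
| D_eq s t : Delta00 (s = t)
| D_lt s t : Delta00 (s < t)
| D_mem t X : Delta00 (t \in X)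
| D_bot : Delta00 Bot
| D_imp a b : Delta00 a -> Delta00 b -> Delta00 (a -> b)
| D_ball t a : Delta00 a -> Delta00 (BAllNum t a)
| D_bex t a : Delta00 a -> Delta00 (BExNum t a).

Definition Sigma01 (a : form) : Prop := (exists b, Delta00 b /\ a = ExNum b)%type.
Definition Pi01 (a : form) : Prop := (exists b, Delta00 b /\ a = AllNum b)%type.

(* a(n + 1), for a formula a(n) whose number variable n has index 0 *)
Definition succ_inst (a : form) : form :=
  subst (scons (#0 + 1)%term (fun n => tvar (S n))) (fun X => X) a.

(* Free number variables of index > 0 and all free set variables of [a], [b] in
   the two schemes are parameters. *)
Inductive RCA0 : form -> Prop :=
| ax_succ_neq0 : RCA0 (~ (#0 + 1 = 0))
| ax_succ_inj : RCA0 (#0 + 1 = #1 + 1 -> #0 = #1)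
| ax_add0 : RCA0 (#0 + 0 = #0)
| ax_addS : RCA0 (#0 + (#1 + 1) = (#0 + #1) + 1)
| ax_mul0 : RCA0 (#0 * 0 = 0)
| ax_mulS : RCA0 (#0 * (#1 + 1) = #0 * #1 + #0)
| ax_lt0 : RCA0 (~ (#0 < 0))
| ax_ltS : RCA0 (#0 < #1 + 1 <-> (#0 < #1 \/ #0 = #1))
| ax_induction a :
    Sigma01 a ->
    RCA0 ((instN 0 a /\ AllNum (a -> succ_inst a)) -> AllNum a)
| ax_comprehension a b :
    Sigma01 a -> Pi01 b ->
    RCA0 (AllNum (a <-> b) -> ExSet (AllNum (#0 \in 0 <-> shiftS a))).

(** * Orders and interval orders, as formulas of second-order arithmetic

    Arguments of type [nat] are indices of set variables. *)

(* the usual code (s, t) = (s + t)^2 + s of a pair of numbers *)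
Definition code (s t : term) : term := (s + t) * (s + t) + s.

(* X is a set of (codes of) pairs in A x B *)
Definition subset_prod (X A B : nat) : form :=
  AllNum (#0 \in X -> ExNum (ExNum (#1 \in A /\ #0 \in B /\ #2 = code #1 #0))).

Definition inrel (R : nat) (s t : term) : form := code s t \in R.
Definition instrict (R : nat) (s t : term) : form := inrel R s t /\ ~ (s = t).

Definition partial_order (P R : nat) : form :=
  subset_prod R P P
  /\ AllNum (#0 \in P -> inrel R #0 #0)
  /\ AllNum (AllNum (AllNum (inrel R #2 #1 -> inrel R #1 #0 -> inrel R #2 #0)))
  /\ AllNum (AllNum (inrel R #1 #0 -> inrel R #0 #1 -> #1 = #0)).

Definition linear_order (L R : nat) : form :=
  partial_order L R
  /\ AllNum (AllNum (#1 \in L -> #0 \in L -> inrel R #1 #0 \/ inrel R #0 #1)).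

(* F is (the graph of) a function from A to B *)
Definition is_function (F A B : nat) : form :=
  subset_prod F A B
  /\ AllNum (#0 \in A ->
       ExNum (inrel F #1 #0 /\ AllNum (inrel F #2 #0 -> #0 = #1))).

(* a(F(s), G(t)); in [a] the values F(s) and G(t) are #1 and #0 *)
Definition with_values (F : nat) (s : term) (G : nat) (t : term) (a : form)
    : form :=
  ExNum (ExNum (inrel F (tshift (tshift s)) #1 /\ inrel G (tshift (tshift t)) #0 /\ a)).

Definition c1 (P leL f0 f1 : nat) : form :=
  AllNum (#0 \in P -> with_values f0 #0 f1 #0 (inrel leL #1 #0)).

Definition c2 (P leP leL f0 f1 : nat) : form :=
  AllNum (AllNum (#1 \in P -> #0 \in P ->
    (instrict leP #1 #0 <-> with_values f1 #1 f0 #0 (instrict leL #1 #0)))).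

(* [i], [j] in {0, 1} appear in the formula as the numerals 0 and 1 *)
Definition c4_at (P f0 f1 : nat) (i j : bool) : form :=
  let f (b : bool) := if b then f1 else f0 in
  let num (b : bool) := if b then tone else tzero in
  AllNum (AllNum (#1 \in P -> #0 \in P ->
    (~ (#1 = #0) \/ ~ (num i = num j)) ->
    with_values (f i) #1 (f j) #0 (~ (#1 = #0)))).

Definition c4 (P f0 f1 : nat) : form :=
  c4_at P f0 f1 false false /\ c4_at P f0 f1 false true
  /\ c4_at P f0 f1 true false /\ c4_at P f0 f1 true true.

(* (L, leL), f0, f1 witness that (P, leP) is a closed interval order *)
Definition interval_rep (P leP L leL f0 f1 : nat) : form :=
  linear_order L leL /\ is_function f0 P L /\ is_function f1 P L
  /\ c1 P leL f0 f1 /\ c2 P leP leL f0 f1.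

(* The four quantifiers bind L, leL, f0, f1 in this order, so that these have
   indices 3, 2, 1, 0 and the outer P, leP are shifted by 4. *)
Definition closed_interval_order (P leP : nat) : form :=
  partial_order P leP
  /\ ExSet (ExSet (ExSet (ExSet (interval_rep (4 + P) (4 + leP) 3 2 1 0)))).

Definition distinguishing_interval_order (P leP : nat) : form :=
  partial_order P leP
  /\ ExSet (ExSet (ExSet (ExSet (
       interval_rep (4 + P) (4 + leP) 3 2 1 0 /\ c4 (4 + P) 1 0)))).

Definition closed_implies_distinguishing : form :=
  AllSet (AllSet (closed_interval_order 1 0 -> distinguishing_interval_order 1 0)).

(* Main.v *)
(** By Henkin's completeness theorem it is enough to work in an arbitrary model of
    RCA0. There, the endpoint [f_i(p)] is replaced by the number [2p + i], and
    [2p + i] is put before [2q + j] when [(f_i(p), i, p)] precedes [(f_j(q), j, q)]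
    lexicographically. Points are thereby separated, and when [f_1(p) = f_0(q)] the
    right endpoint of [p] still comes after the left endpoint of [q], so that the
    order [P] is unchanged. The new linear order is Delta01: it is Sigma01 because
    values of functions are witnessed, and so is its complement by totality. *)

From Stdlib Require Import List Arith Lia Cantor Classical ClassicalEpsilon.
From Stdlib Require Import FunctionalExtensionality PropExtensionality Ring.
Require Import Defs.
Import ListNotations.

(** * Substitution *)

(** A model of RCA0 may be nonstandard, and it has only the sets that the axioms provide.
    Commutativity of addition, the trichotomy of [<] and the injectivity of pairing must therefore
    all come from induction inside the model, with an explicit definition of each induction
    predicate. This also fixes the order of the development: merging two existential quantifiers
    needs a bound above both witnesses, so the elementary order facts are proved using predicates
    with a single leading existential quantifier.

    The old values cannot serve as points, since several endpoints may share one value. The codes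
    [2p + i] are chosen because every number has exactly one such form: a number fails to be a point
    exactly when its [p] lies outside [P], which makes the complement of the set of points
    definable. Comparing two codes requires the values of the given functions. These have no bound
    in terms of [p], so the comparison is not a bounded formula, and both the order and its
    complement are written with existential witnesses. *)

Definition up (s : nat -> term) : nat -> term :=
  scons (tvar 0) (fun n => tshift (s n)).
Definition upr (r : nat -> nat) : nat -> nat := scons 0 (fun n => S (r n)).

Lemma tsubst_comp s s' t :
  tsubst s' (tsubst s t) = tsubst (fun n => tsubst s' (s n)) t.
Proof. induction t; cbn; congruence. Qed.

Lemma tsubst_var t : tsubst tvar t = t.
Proof. induction t; cbn; congruence. Qed.

Lemma up_comp s s' :
  (fun n => tsubst (up s') (up s n)) = up (fun n => tsubst s' (s n)).
Proof.
  extensionality n; destruct n; cbn; [reflexivity|].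
  unfold tshift; now rewrite !tsubst_comp.
Qed.

Lemma upr_comp r r' : (fun n => upr r' (upr r n)) = upr (fun n => r' (r n)).
Proof. now extensionality n; destruct n. Qed.

Lemma up_var : up tvar = tvar.
Proof. now extensionality n; destruct n. Qed.

Lemma upr_id : upr (fun X => X) = fun X => X.
Proof. now extensionality n; destruct n. Qed.

Lemma subst_comp a : forall s s' r r',
  subst s' r' (subst s r a)
  = subst (fun n => tsubst s' (s n)) (fun X => r' (r X)) a.
Proof.
  induction a; intros f f' r r'; cbn; rewrite ?tsubst_comp; try congruence.
  - now rewrite IHa1, IHa2.
  - rewrite IHa; fold (up f) (up f'); now rewrite up_comp.
  - rewrite IHa; fold (upr r) (upr r'); now rewrite upr_comp.
Qed.

Lemma subst_id a : subst tvar (fun X => X) a = a.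
Proof.
  induction a; cbn [subst]; rewrite ?tsubst_var; try congruence.
  - fold (up tvar); rewrite up_var; congruence.
  - fold (upr (fun X => X)); rewrite upr_id; congruence.
Qed.

Fixpoint tbound (t : term) : nat :=
  match t with
  | tvar n => S n
  | tzero | tone => 0
  | tadd t u | tmul t u => Nat.max (tbound t) (tbound u)
  end.

Fixpoint nbound (a : form) : nat :=
  match a with
  | EqNum t u | LtNum t u => Nat.max (tbound t) (tbound u)
  | MemSet t _ => tbound t
  | Bot => 0
  | Imp a b => Nat.max (nbound a) (nbound b)
  | AllNum a => pred (nbound a)
  | AllSet a => nbound a
  end.

Fixpoint sbound (a : form) : nat :=
  match a with
  | EqNum _ _ | LtNum _ _ | Bot => 0
  | MemSet _ X => S X
  | Imp a b => Nat.max (sbound a) (sbound b)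
  | AllNum a => sbound a
  | AllSet a => pred (sbound a)
  end.

Lemma tsubst_ext s s' t :
  (forall n, n < tbound t -> s n = s' n) -> tsubst s t = tsubst s' t.
Proof.
  induction t; cbn; intros H; auto; rewrite IHt1, IHt2; auto; intros; apply H; lia.
Qed.

Lemma subst_ext a : forall s s' r r',
  (forall n, n < nbound a -> s n = s' n) ->
  (forall X, X < sbound a -> r X = r' X) ->
  subst s r a = subst s' r' a.
Proof.
  induction a; cbn; intros f f' r r' Hs Hr.
  - f_equal; apply tsubst_ext; intros; apply Hs; lia.
  - f_equal; apply tsubst_ext; intros; apply Hs; lia.
  - f_equal; [apply tsubst_ext; auto | apply Hr; lia].
  - reflexivity.
  - f_equal; [apply IHa1 | apply IHa2]; intros; first [apply Hs | apply Hr]; lia.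
  - f_equal; apply IHa; [|auto]. intros [|n] Hn; cbn; [auto|].
    rewrite Hs by lia; auto.
  - f_equal; apply IHa; [auto|]. intros [|n] Hn; cbn; [auto|].
    rewrite Hr by lia; auto.
Qed.

Lemma subst_instN s r t a :
  subst s r (instN t a) = instN (tsubst s t) (subst (up s) r a).
Proof.
  unfold instN; rewrite !subst_comp; f_equal.
  extensionality n; destruct n; cbn; [reflexivity|].
  unfold tshift; rewrite tsubst_comp; cbn; now rewrite tsubst_var.
Qed.

Lemma subst_instS s r Y a :
  subst s r (instS Y a) = instS (r Y) (subst s (upr r) a).
Proof.
  unfold instS; rewrite !subst_comp; f_equal.
  - extensionality n; cbn; now rewrite tsubst_var.
  - now extensionality n; destruct n.
Qed.

Lemma subst_shiftN s r a :
  subst (up s) r (shiftN a) = shiftN (subst s r a).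
Proof. unfold shiftN; now rewrite !subst_comp. Qed.

Lemma subst_shiftS s r a :
  subst s (upr r) (shiftS a) = shiftS (subst s r a).
Proof.
  unfold shiftS; rewrite !subst_comp; f_equal.
  extensionality n; cbn; now rewrite tsubst_var.
Qed.

(** * Structural properties of derivations *)

Section Proves.
Context (T : form -> Prop).

Lemma proves_weaken G a : proves T G a -> forall G', incl G G' -> proves T G' a.
Proof.
  induction 1; intros G' HG.
  - now apply pr_ax.
  - apply pr_hyp; auto.
  - apply pr_impI, IHproves. intros x [->|Hx]; [now left | right; auto].
  - eapply pr_impE; eauto.
  - apply pr_contra, IHproves. intros x [->|Hx]; [now left | right; auto].
  - apply pr_allNI, IHproves; now apply incl_map.
  - apply pr_allNE; auto.
  - apply pr_allSI, IHproves; now apply incl_map.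
  - apply pr_allSE; auto.
  - apply pr_eq_refl.
  - eapply pr_eq_subst; eauto.
Qed.

Lemma iter_up_lt k s n : n < k -> Nat.iter k up s n = tvar n.
Proof.
  revert n; induction k as [|k IH]; intros [|n] Hn; try lia; [reflexivity|].
  rewrite Nat.iter_succ; cbn [up upr scons]; rewrite IH by lia; reflexivity.
Qed.

Lemma iter_up_add k s n :
  Nat.iter k up s (k + n) = tsubst (fun m => tvar (k + m)) (s n).
Proof.
  induction k as [|k IH].
  - symmetry; apply tsubst_var.
  - rewrite Nat.iter_succ; cbn [up scons Nat.add]; rewrite IH.
    unfold tshift; now rewrite tsubst_comp.
Qed.

Lemma subst_iterN k : forall s r a,
  subst s r (Nat.iter k AllNum a) = Nat.iter k AllNum (subst (Nat.iter k up s) r a).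
Proof.
  induction k as [|k IH]; intros; [reflexivity|].
  rewrite !Nat.iter_succ; cbn [subst]; fold (up s); now rewrite IH, <- Nat.iter_succ_r.
Qed.

(** The outermost of [S k] quantifiers binds index [k], so the term [s k] ends up under [k]
    remaining binders, shifted by [k]. The later instantiations undo exactly this shift, and so
    single instantiations add up to one simultaneous substitution. *)
Lemma iterN_elim k (s : nat -> term) G : forall a,
  proves T G (Nat.iter k AllNum a) ->
  proves T G (subst (fun n => if n <? k then s n else tvar (n - k)) (fun X => X) a).
Proof.
  induction k as [|k IH]; intros a H.
  - replace (fun n => _) with tvar; [now rewrite subst_id|].
    extensionality n; cbn; now rewrite Nat.sub_0_r.
  - rewrite Nat.iter_succ in H; apply pr_allNE with (t := s k) in H; unfold instN in H.
    rewrite subst_iterN in H; apply IH in H; rewrite subst_comp in H.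
    erewrite subst_ext; [exact H | | reflexivity].
    intros n _; cbn beta.
    destruct (lt_dec n k).
    + rewrite iter_up_lt by lia; cbn [tsubst].
      destruct (Nat.ltb_spec n (S k)), (Nat.ltb_spec n k); try lia; auto.
    + assert (E0 : Nat.iter k up (scons (s k) tvar) n
                   = tsubst (fun m => tvar (k + m)) (scons (s k) tvar (n - k))).
      { rewrite <- iter_up_add; f_equal; lia. }
      rewrite E0, tsubst_comp.
      assert (E : (fun m => tsubst (fun n0 => if n0 <? k then s n0 else tvar (n0 - k))
                    (tvar (k + m))) = tvar).
      { extensionality m; cbn [tsubst]. destruct (Nat.ltb_spec (k + m) k); [lia|].
        f_equal; lia. }
      rewrite E, tsubst_var.
      destruct (Nat.ltb_spec n (S k)).
      * now replace (n - k) with 0 by lia; replace n with k by lia.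
      * replace (n - k) with (S (n - S k)) by lia; reflexivity.
Qed.

Lemma iter_upr_lt k r n : n < k -> Nat.iter k upr r n = n.
Proof.
  revert n; induction k as [|k IH]; intros [|n] Hn; try lia; [reflexivity|].
  rewrite Nat.iter_succ; cbn [up upr scons]; rewrite IH by lia; reflexivity.
Qed.

Lemma iter_upr_add k r n : Nat.iter k upr r (k + n) = k + r n.
Proof.
  induction k as [|k IH]; [reflexivity|].
  rewrite Nat.iter_succ; cbn [upr scons Nat.add]; now rewrite IH.
Qed.

Lemma subst_iterS k : forall s r a,
  subst s r (Nat.iter k AllSet a) = Nat.iter k AllSet (subst s (Nat.iter k upr r) a).
Proof.
  induction k as [|k IH]; intros; [reflexivity|].
  rewrite !Nat.iter_succ; cbn [subst]; fold (upr r); now rewrite IH, <- Nat.iter_succ_r.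
Qed.

Lemma iterS_elim k (r : nat -> nat) G : forall a,
  proves T G (Nat.iter k AllSet a) ->
  proves T G (subst tvar (fun n => if n <? k then r n else n - k) a).
Proof.
  induction k as [|k IH]; intros a H.
  - replace (fun n => _) with (fun X : nat => X); [now rewrite subst_id|].
    extensionality n; cbn; now rewrite Nat.sub_0_r.
  - rewrite Nat.iter_succ in H; apply pr_allSE with (Y := r k) in H; unfold instS in H.
    rewrite subst_iterS in H; apply IH in H; rewrite subst_comp in H.
    erewrite subst_ext; [exact H | reflexivity |].
    intros n _; cbn beta.
    destruct (lt_dec n k).
    + rewrite iter_upr_lt by lia.
      destruct (Nat.ltb_spec n (S k)), (Nat.ltb_spec n k); try lia; auto.
    + assert (E0 : Nat.iter k upr (scons (r k) (fun X => X)) n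
                   = k + scons (r k) (fun X => X) (n - k)).
      { rewrite <- iter_upr_add; f_equal; lia. }
      rewrite E0.
      match goal with |- _ = if ?x <? k then _ else _ =>
        destruct (Nat.ltb_spec x k); [lia|] end.
      destruct (Nat.ltb_spec n (S k)).
      * replace (n - k) with 0 by lia; replace n with k by lia; cbn; lia.
      * replace (n - k) with (S (n - S k)) by lia; cbn; lia.
Qed.

(** [T] need not be closed under substitution. But an axiom is available in every context, including
    the shifted ones of the introduction rules, so its free variables can all be generalized and
    then instantiated, first the numbers and then the sets. *)
Lemma ax_subst s r a G : T a -> proves T G (subst s r a).
Proof.
  intros Ha.
  assert (H1 : forall k G, proves T G (Nat.iter k AllNum a)).
  { induction k; intros G'; rewrite ?Nat.iter_succ; [now apply pr_ax | now apply pr_allNI]. }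
  assert (H2 : forall G, proves T G (subst s (fun X => X) a)).
  { intros G'; specialize (H1 (nbound a) G'); apply iterN_elim with (s := s) in H1.
    erewrite subst_ext; [exact H1 | | reflexivity].
    intros n Hn; cbn beta; destruct (Nat.ltb_spec n (nbound a)); [auto|lia]. }
  set (b := subst s (fun X => X) a) in *.
  assert (H3 : forall k G, proves T G (Nat.iter k AllSet b)).
  { induction k; intros G'; rewrite ?Nat.iter_succ; [apply H2 | now apply pr_allSI]. }
  replace (subst s r a) with (subst tvar r b).
  - specialize (H3 (sbound b) G); apply iterS_elim with (r := r) in H3.
    erewrite subst_ext; [exact H3 | reflexivity |].
    intros n Hn; cbn beta; destruct (Nat.ltb_spec n (sbound b)); [auto|lia].
  - unfold b; rewrite subst_comp; f_equal; extensionality n; apply tsubst_var.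
Qed.

Lemma proves_subst G a : proves T G a ->
  forall s r, proves T (map (subst s r) G) (subst s r a).
Proof.
  induction 1; intros s r.
  - now apply ax_subst.
  - now apply pr_hyp, in_map.
  - now apply pr_impI, IHproves.
  - eapply pr_impE; [apply IHproves1 | apply IHproves2].
  - now apply pr_contra, IHproves.
  - cbn; fold (up s); apply pr_allNI.
    replace (map shiftN _) with (map (subst (up s) r) (map shiftN G)); [auto|].
    rewrite !map_map; apply map_ext; intros; apply subst_shiftN.
  - rewrite subst_instN; apply pr_allNE, IHproves.
  - cbn; fold (upr r); apply pr_allSI.
    replace (map shiftS _) with (map (subst s (upr r)) (map shiftS G)); [auto|].
    rewrite !map_map; apply map_ext; intros; apply subst_shiftS.
  - rewrite subst_instS; apply pr_allSE, IHproves.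
  - apply pr_eq_refl.
  - rewrite subst_instN; eapply pr_eq_subst; [apply IHproves1|].
    rewrite <- subst_instN; apply IHproves2.
Qed.

(** Renaming [c] to index 0 and shifting all other variables turns the given derivation into a
    premise of [pr_allNI]. As [c] is fresh, the hypotheses are merely shifted. *)
Lemma fresh_allN c b G :
  (forall a, In a (b :: G) -> nbound a <= c) ->
  proves T G (instN (tvar c) b) -> proves T G (AllNum b).
Proof.
  intros Hc H; apply pr_allNI.
  set (s n := if n =? c then tvar 0 else tvar (S n)).
  apply proves_subst with (s := s) (r := fun X => X) in H.
  assert (E1 : map (subst s (fun X => X)) G = map shiftN G).
  { apply map_ext_in; intros a Ha; apply subst_ext; [|reflexivity].
    intros n Hn; unfold s. specialize (Hc a (or_intror Ha)).
    destruct (Nat.eqb_spec n c); [lia|reflexivity]. }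
  rewrite E1 in H. unfold instN in H; rewrite subst_comp in H.
  rewrite <- (subst_id b).
  erewrite subst_ext; [exact H | | reflexivity].
  specialize (Hc b (or_introl eq_refl)).
  intros [|n] Hn; cbn; unfold s.
  - now rewrite Nat.eqb_refl.
  - destruct (Nat.eqb_spec n c); [lia|reflexivity].
Qed.

Lemma fresh_allS c b G :
  (forall a, In a (b :: G) -> sbound a <= c) ->
  proves T G (instS c b) -> proves T G (AllSet b).
Proof.
  intros Hc H; apply pr_allSI.
  set (r n := if n =? c then 0 else S n).
  apply proves_subst with (s := tvar) (r := r) in H.
  assert (E1 : map (subst tvar r) G = map shiftS G).
  { apply map_ext_in; intros a Ha; apply subst_ext; [reflexivity|].
    intros n Hn; unfold r. specialize (Hc a (or_intror Ha)).
    destruct (Nat.eqb_spec n c); [lia|reflexivity]. }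
  rewrite E1 in H. unfold instS in H; rewrite subst_comp in H.
  rewrite <- (subst_id b).
  erewrite subst_ext; [exact H | reflexivity |].
  specialize (Hc b (or_introl eq_refl)).
  intros [|n] Hn; cbn; unfold r.
  - now rewrite Nat.eqb_refl.
  - destruct (Nat.eqb_spec n c); [lia|reflexivity].
Qed.

End Proves.

(** * Numbering of formulas *)

Fixpoint tcode (t : term) : nat :=
  match t with
  | tvar n => to_nat (0, n)
  | tzero => to_nat (1, 0)
  | tone => to_nat (2, 0)
  | tadd t u => to_nat (3, to_nat (tcode t, tcode u))
  | tmul t u => to_nat (4, to_nat (tcode t, tcode u))
  end.

Fixpoint fcode (a : form) : nat :=
  match a with
  | EqNum t u => to_nat (0, to_nat (tcode t, tcode u))
  | LtNum t u => to_nat (1, to_nat (tcode t, tcode u))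
  | MemSet t X => to_nat (2, to_nat (tcode t, X))
  | Bot => to_nat (3, 0)
  | Imp a b => to_nat (4, to_nat (fcode a, fcode b))
  | AllNum a => to_nat (5, fcode a)
  | AllSet a => to_nat (6, fcode a)
  end.

Lemma to_nat_pair_inj a b c d : to_nat (a, b) = to_nat (c, d) -> a = c /\ b = d.
Proof. intros H; apply to_nat_inj in H; now inversion H. Qed.

Ltac code_inj :=
  repeat match goal with
  | H : to_nat _ = to_nat _ |- _ =>
      apply to_nat_pair_inj in H; destruct H as [? ?]; try discriminate
  end.

Lemma tcode_inj t u : tcode t = tcode u -> t = u.
Proof.
  revert u; induction t; intros []; cbn -[to_nat]; intros H; code_inj;
    f_equal; auto.
Qed.

Lemma fcode_inj a b : fcode a = fcode b -> a = b.
Proof.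
  revert b; induction a; intros []; cbn -[to_nat]; intros H; code_inj;
    f_equal; auto using tcode_inj.
Qed.

(** Injectivity of the codes replaces a decoder: [epsilon] picks the formula with code [n], and an
    arbitrary one if [n] codes nothing. *)
Lemma form_enum : exists e : nat -> form, forall a, exists n, e n = a.
Proof.
  exists (fun n => epsilon (inhabits Bot) (fun a => fcode a = n)).
  intros a; exists (fcode a); apply fcode_inj.
  apply (epsilon_spec (inhabits Bot) (fun b => fcode b = fcode a)).
  now exists a.
Qed.

(** * Semantics and completeness *)

(** General (Henkin) semantics: set quantifiers range over an arbitrary type with a membership
    relation. The language has no equality of sets, so distinct elements of [sets] may have the same
    members. *)
Record structure : Type := {
  num : Type;
  zero : num;
  one : num;
  add : num -> num -> num;
  mul : num -> num -> num;
  lt : num -> num -> Prop;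
  sets : Type;
  mem : num -> sets -> Prop }.

Arguments zero {_}.
Arguments one {_}.
Arguments add {_} _ _.
Arguments mul {_} _ _.
Arguments lt {_} _ _.
Arguments mem {_} _ _.

Section Semantics.
Context {M : structure}.

Fixpoint eval (v : nat -> num M) (t : term) : num M :=
  match t with
  | tvar n => v n
  | tzero => zero
  | tone => one
  | tadd t u => add (eval v t) (eval v u)
  | tmul t u => mul (eval v t) (eval v u)
  end.

Fixpoint sat (v : nat -> num M) (w : nat -> sets M) (a : form) : Prop :=
  match a with
  | EqNum t u => eval v t = eval v u
  | LtNum t u => lt (eval v t) (eval v u)
  | MemSet t X => mem (eval v t) (w X)
  | Bot => False
  | Imp a b => sat v w a -> sat v w b
  | AllNum a => forall x, sat (scons x v) w a
  | AllSet a => forall X, sat v (scons X w) a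
  end.

End Semantics.

Definition models (M : structure) (T : form -> Prop) : Prop :=
  forall a, T a -> forall (v : nat -> num M) (w : nat -> sets M), sat v w a.

(** * The Henkin construction *)

Section Henkin.
Context (T : form -> Prop).

Definition consistent (G : list form) : Prop := ~ proves T G Bot.

Definition fresh (f : form -> nat) (G : list form) : nat := list_max (map f G).

Lemma fresh_spec f G a : In a G -> f a <= fresh f G.
Proof.
  intros Ha; pose proof (proj1 (list_max_le (map f G) _) (le_n _)) as H.
  rewrite Forall_forall in H; apply H, in_map, Ha.
Qed.

(** Free variables act as Henkin constants; a fresh one always exists because contexts are finite
    lists. Since [ExNum] and [ExSet] unfold to negated universals, these are the only shapes to be
    witnessed. *)
Definition witness (a : form) (G : list form) : list form :=
  match a with
  | Imp (AllNum b) Bot => [Neg (instN (tvar (fresh nbound (b :: G))) b)]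
  | Imp (AllSet b) Bot => [Neg (instS (fresh sbound (b :: G)) b)]
  | _ => []
  end.

Definition extend (a : form) (G : list form) : list form :=
  if excluded_middle_informative (consistent (a :: G))
  then witness a (a :: G) ++ a :: G else G.

(** If a witness caused inconsistency, [pr_contra] would derive the instance at the fresh variable,
    hence the universal formula whose negation has just been added. *)
Lemma extend_consistent a G : consistent G -> consistent (extend a G).
Proof.
  intros HG; unfold extend.
  destruct excluded_middle_informative as [Ha|]; [|assumption].
  destruct a as [| | | | a b | |]; try exact Ha.
  destruct a as [| | | | | a | a]; try exact Ha; destruct b; try exact Ha;
    cbn [witness app].
  - intros H; apply Ha; apply pr_contra in H; apply fresh_allN in H.
    + eapply pr_impE; [apply pr_hyp; now left | exact H].
    + intros x Hx; now apply fresh_spec.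
  - intros H; apply Ha; apply pr_contra in H; apply fresh_allS in H.
    + eapply pr_impE; [apply pr_hyp; now left | exact H].
    + intros x Hx; now apply fresh_spec.
Qed.

Lemma extend_incl a G : incl G (extend a G).
Proof.
  unfold extend; destruct excluded_middle_informative; [|apply incl_refl].
  apply incl_appr, incl_tl, incl_refl.
Qed.

Context (e : nat -> form) (He : forall a, exists n, e n = a).
Context (G0 : list form) (HG0 : consistent G0).

Fixpoint chain (n : nat) : list form :=
  match n with 0 => G0 | S n => extend (e n) (chain n) end.

Lemma chain_consistent n : consistent (chain n).
Proof. induction n; cbn; auto using extend_consistent. Qed.

Lemma chain_incl m n : m <= n -> incl (chain m) (chain n).
Proof.
  induction 1; [apply incl_refl|].
  eapply incl_tran; [eassumption | apply extend_incl].
Qed.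

(** Stands in for membership in a maximal consistent set; taking provability from some stage makes
    it deductively closed from the outset. *)
Definition holds (a : form) : Prop := exists n, proves T (chain n) a.

Lemma holds_proves a : proves T G0 a -> holds a.
Proof. now exists 0. Qed.

Lemma holds_any a : (forall G, proves T G a) -> holds a.
Proof. intros H; exists 0; apply H. Qed.

Lemma holds_rule2 a b c :
  (forall G, proves T G a -> proves T G b -> proves T G c) ->
  holds a -> holds b -> holds c.
Proof.
  intros H [m Hm] [n Hn]; exists (Nat.max m n); apply H;
    (eapply proves_weaken; [eassumption | apply chain_incl; lia]).
Qed.

Lemma holds_rule1 a c :
  (forall G, proves T G a -> proves T G c) -> holds a -> holds c.
Proof. intros H Ha; apply (holds_rule2 a a); auto. Qed.

Lemma holds_bot : ~ holds Bot.
Proof. intros [n H]; exact (chain_consistent n H). Qed.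

Lemma holds_mp a b : holds (Imp a b) -> holds a -> holds b.
Proof. apply holds_rule2; intros; eapply pr_impE; eauto. Qed.

Lemma extend_witness a : holds (Neg a) ->
  exists n, incl (witness (Neg a) (Neg a :: chain n)) (chain (S n)).
Proof.
  intros Ha; destruct (He (Neg a)) as [n Hn]; exists n; cbn [chain]; rewrite Hn.
  unfold extend; destruct excluded_middle_informative as [|H].
  - apply incl_appl, incl_refl.
  - exfalso; apply H; intros K; apply holds_bot.
    eapply holds_mp; [|exact Ha]. exists n; now apply pr_impI.
Qed.

(** The stage at which [a] is enumerated decides it: [a] is added if consistent with that stage, and
    is refuted by it otherwise. *)
Lemma holds_neg a : ~ holds a -> holds (Neg a).
Proof.
  intros Ha; destruct (He a) as [n Hn].
  destruct (classic (consistent (a :: chain n))) as [H|H].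
  - exfalso; apply Ha; exists (S n); apply pr_hyp; cbn; unfold extend; rewrite Hn.
    destruct excluded_middle_informative as [|F]; [|contradiction].
    apply in_or_app; right; now left.
  - apply NNPP in H. exists n; now apply pr_impI.
Qed.

Lemma holds_imp a b : holds (Imp a b) <-> (holds a -> holds b).
Proof.
  split; [apply holds_mp|]. intros H.
  destruct (classic (holds a)) as [Ha|Ha].
  - apply (holds_rule1 b); [|auto]. intros G K; apply pr_impI.
    eapply proves_weaken; [exact K | apply incl_tl, incl_refl].
  - apply holds_neg in Ha; revert Ha; apply holds_rule1; intros G K.
    apply pr_impI, pr_contra; eapply pr_impE.
    + eapply proves_weaken; [exact K | apply incl_tl, incl_tl, incl_refl].
    + apply pr_hyp; right; now left.
Qed.

Lemma holds_allN a : holds (AllNum a) <-> forall t, holds (instN t a).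
Proof.
  split.
  - intros H t; revert H; apply holds_rule1; intros G; apply pr_allNE.
  - intros H; apply NNPP; intros Ha; apply holds_neg, extend_witness in Ha.
    destruct Ha as [n Hn]; cbn [witness Neg] in Hn.
    apply holds_bot; eapply holds_mp; [|apply H].
    exists (S n); apply pr_hyp, Hn; now left.
Qed.

Lemma holds_allS a : holds (AllSet a) <-> forall Y, holds (instS Y a).
Proof.
  split.
  - intros H Y; revert H; apply holds_rule1; intros G; apply pr_allSE.
  - intros H; apply NNPP; intros Ha; apply holds_neg, extend_witness in Ha.
    destruct Ha as [n Hn]; cbn [witness Neg] in Hn.
    apply holds_bot; eapply holds_mp; [|apply H].
    exists (S n); apply pr_hyp, Hn; now left.
Qed.

Lemma holds_eq_subst t u a :
  holds (EqNum t u) -> holds (instN t a) -> holds (instN u a).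
Proof. apply holds_rule2; intros; eapply pr_eq_subst; eauto. Qed.

Lemma instN_shift t u : tsubst (scons t tvar) (tshift u) = u.
Proof. unfold tshift; rewrite tsubst_comp; apply tsubst_var. Qed.

Lemma holds_refl t : holds (EqNum t t).
Proof. apply holds_any; intros; apply pr_eq_refl. Qed.

Lemma holds_sym t u : holds (EqNum t u) -> holds (EqNum u t).
Proof.
  intros H. pose proof (holds_eq_subst t u (EqNum (tvar 0) (tshift t)) H) as K.
  cbn in K; rewrite !instN_shift in K; auto using holds_refl.
Qed.

Lemma holds_trans t u v : holds (EqNum t u) -> holds (EqNum u v) -> holds (EqNum t v).
Proof.
  intros H H'. pose proof (holds_eq_subst u v (EqNum (tshift t) (tvar 0)) H') as K.
  cbn in K; rewrite !instN_shift in K; auto.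
Qed.

Lemma holds_cong (f : term -> term -> term) t t' u u' :
  (forall s x y, tsubst s (f x y) = f (tsubst s x) (tsubst s y)) ->
  holds (EqNum t t') -> holds (EqNum u u') -> holds (EqNum (f t u) (f t' u')).
Proof.
  intros Hf H1 H2.
  pose proof (holds_eq_subst t t' (EqNum (tshift (f t u)) (f (tvar 0) (tshift u))) H1) as K1.
  pose proof (holds_eq_subst u u' (EqNum (tshift (f t u)) (f (tshift t') (tvar 0))) H2) as K2.
  cbn in K1, K2; rewrite !Hf, !instN_shift in K1, K2; auto using holds_refl.
Qed.

(** The predicate passed to [epsilon] depends only on the provable-equality class of [t], so all
    terms of a class get the same representative. The quotient is then the subtype of terms fixed by
    [nf]. *)
Definition nf (t : term) : term :=
  epsilon (inhabits tzero) (fun u => holds (EqNum t u)).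

Lemma nf_spec t : holds (EqNum t (nf t)).
Proof.
  apply (epsilon_spec (inhabits tzero) (fun u => holds (EqNum t u))).
  exists t; apply holds_refl.
Qed.

Lemma nf_eq t u : nf t = nf u <-> holds (EqNum t u).
Proof.
  split.
  - intros H; eapply holds_trans; [apply nf_spec|]. rewrite H; apply holds_sym, nf_spec.
  - intros H; unfold nf; f_equal; extensionality x; apply propositional_extensionality.
    split; intros K; eapply holds_trans; eauto using holds_sym.
Qed.

Definition cls (t : term) : {t | nf t = t}.
Proof. exists (nf t); apply nf_eq, holds_sym, nf_spec. Defined.

Lemma cls_eq t u : cls t = cls u <-> holds (EqNum t u).
Proof.
  rewrite <- nf_eq; split; intros H.
  - now apply (f_equal (@proj1_sig _ _)) in H.
  - unfold cls; apply eq_sig_hprop; [intros; apply proof_irrelevance | exact H].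
Qed.

Lemma cls_val x : cls (proj1_sig x) = x.
Proof. apply eq_sig_hprop; [intros; apply proof_irrelevance | exact (proj2_sig x)]. Qed.

Lemma val_cls t : holds (EqNum (proj1_sig (cls t)) t).
Proof. apply holds_sym, nf_spec. Qed.

Definition henkin : structure := {|
  num := {t | nf t = t};
  zero := cls tzero;
  one := cls tone;
  add x y := cls (tadd (proj1_sig x) (proj1_sig y));
  mul x y := cls (tmul (proj1_sig x) (proj1_sig y));
  lt x y := holds (LtNum (proj1_sig x) (proj1_sig y));
  sets := nat;
  mem x X := holds (MemSet (proj1_sig x) X) |}.

Lemma henkin_eval s t :
  eval (M := henkin) (fun n => cls (s n)) t = cls (tsubst s t).
Proof.
  induction t; cbn -[cls]; auto; rewrite IHt1, IHt2; apply cls_eq;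
    apply holds_cong; auto using val_cls.
Qed.

(** The truth lemma, for arbitrary substitutions so that the induction passes under binders.
    Quantifiers match because every element of the domain is the class of a term and the sets are
    the set variables. *)
Lemma henkin_sat a : forall s r,
  sat (M := henkin) (fun n => cls (s n)) r a <-> holds (subst s r a).
Proof.
  induction a; intros s' r; cbn [sat subst].
  - rewrite !henkin_eval; apply cls_eq.
  - rewrite !henkin_eval; cbn [henkin lt].
    set (t1 := tsubst s' s); set (t2 := tsubst s' t).
    assert (H : forall x x' y y', holds (EqNum x x') -> holds (EqNum y y') ->
              holds (LtNum x y) -> holds (LtNum x' y')).
    { intros x x' y y' Hx Hy.
      pose proof (holds_eq_subst x x' (LtNum (tvar 0) (tshift y)) Hx) as K1.
      pose proof (holds_eq_subst y y' (LtNum (tshift x') (tvar 0)) Hy) as K2.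
      cbn in K1, K2; rewrite !instN_shift in K1, K2; auto. }
    split; apply H; auto using val_cls, holds_sym.
  - rewrite !henkin_eval; cbn [henkin mem].
    assert (H : forall x x' Y, holds (EqNum x x') ->
              holds (MemSet x Y) -> holds (MemSet x' Y)).
    { intros x x' Y Hx; exact (holds_eq_subst x x' (MemSet (tvar 0) Y) Hx). }
    split; apply H; auto using val_cls, holds_sym.
  - split; [contradiction | apply holds_bot].
  - rewrite holds_imp, IHa1, IHa2; reflexivity.
  - rewrite holds_allN; fold (up s').
    assert (E : forall t, holds (instN t (subst (up s') r a))
                <-> sat (M := henkin) (scons (cls t) (fun n => cls (s' n))) r a).
    { intros t.
      replace (scons (cls t) (fun n => cls (s' n))) with (fun n => cls (scons t s' n))
        by now extensionality n; destruct n.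
      rewrite IHa; unfold instN; rewrite subst_comp.
      replace (fun n => tsubst (scons t tvar) (up s' n)) with (scons t s');
        [reflexivity|].
      extensionality n; destruct n; cbn; [reflexivity|]. now rewrite instN_shift. }
    split; intros H.
    + intros t; apply E, H.
    + intros x; rewrite <- (cls_val x); apply E, H.
  - rewrite holds_allS; fold (upr r). cbn [henkin sets].
    assert (E : forall Y, holds (instS Y (subst s' (upr r) a))
                <-> sat (M := henkin) (fun n => cls (s' n)) (scons Y r) a).
    { intros Y; rewrite IHa; unfold instS; rewrite subst_comp.
      replace (fun n => tsubst tvar (s' n)) with s'
        by (extensionality n; now rewrite tsubst_var).
      replace (fun n => scons Y (fun X => X) (upr r n)) with (scons Y r)
        by now extensionality n; destruct n.
      reflexivity. }
    split; intros H Y; apply E, H.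
Qed.

Lemma henkin_models : models henkin T.
Proof.
  intros a Ha v r.
  replace v with (fun n => cls (proj1_sig (v n))) by (extensionality n; apply cls_val).
  apply henkin_sat, holds_any; intros G; now apply ax_subst.
Qed.

End Henkin.

Theorem completeness (T : form -> Prop) (a : form) :
  (forall M, models M T -> forall (v : nat -> num M) (w : nat -> sets M), sat v w a) ->
  provable T a.
Proof.
  intros H; apply pr_contra, NNPP; intros Hcon.
  destruct form_enum as [e He].
  specialize (H _ (henkin_models T e He [Neg a] Hcon)).
  specialize (H (fun n => cls T e [Neg a] (tvar n)) (fun X => X)).
  apply (henkin_sat T e He [Neg a] Hcon a tvar (fun X => X)) in H.
  rewrite subst_id in H.
  apply (holds_bot T e [Neg a] Hcon).
  eapply holds_mp; [|exact H]. apply holds_proves, pr_hyp; now left.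
Qed.

(** * Definability in models of RCA0 *)

Section Connectives.
Context {M : structure} (v : nat -> num M) (w : nat -> sets M).

Lemma sat_neg a : sat v w (Neg a) <-> ~ sat v w a.
Proof. reflexivity. Qed.

Lemma sat_imp a b : sat v w (Imp a b) <-> (sat v w a -> sat v w b).
Proof. reflexivity. Qed.

Lemma sat_allN a : sat v w (AllNum a) <-> forall x, sat (scons x v) w a.
Proof. reflexivity. Qed.

Lemma sat_and a b : sat v w (And a b) <-> sat v w a /\ sat v w b.
Proof. cbn; tauto. Qed.

Lemma sat_or a b : sat v w (Or a b) <-> sat v w a \/ sat v w b.
Proof. cbn; tauto. Qed.

Lemma sat_iff a b : sat v w (Iff a b) <-> (sat v w a <-> sat v w b).
Proof. unfold Iff; rewrite sat_and; reflexivity. Qed.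

Lemma sat_exN a : sat v w (ExNum a) <-> exists x, sat (scons x v) w a.
Proof.
  cbn; split; [|firstorder].
  intros H; apply NNPP; intros K; apply H; intros x Hx; apply K; now exists x.
Qed.

Lemma sat_exS a : sat v w (ExSet a) <-> exists X, sat v (scons X w) a.
Proof.
  cbn; split; [|firstorder].
  intros H; apply NNPP; intros K; apply H; intros x Hx; apply K; now exists x.
Qed.

End Connectives.

Lemma eval_tsubst {M : structure} (v : nat -> num M) s t :
  eval v (tsubst s t) = eval (fun n => eval v (s n)) t.
Proof. induction t; cbn; congruence. Qed.

Lemma eval_tshift {M : structure} x (v : nat -> num M) t :
  eval (scons x v) (tshift t) = eval v t.
Proof. apply eval_tsubst. Qed.

Lemma sat_subst {M : structure} a : forall s r (v : nat -> num M) w,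
  sat v w (subst s r a) <-> sat (fun n => eval v (s n)) (fun X => w (r X)) a.
Proof.
  induction a; intros s' r v w; cbn [sat subst]; rewrite ?eval_tsubst.
  1-4: reflexivity.
  - now rewrite IHa1, IHa2.
  - apply (Morphisms_Prop.all_iff_morphism); intros x; rewrite IHa.
    replace (fun n => _) with (scons x (fun n => eval v (s' n))); [reflexivity|].
    extensionality n; destruct n; cbn; [reflexivity|]. now rewrite eval_tshift.
  - apply (Morphisms_Prop.all_iff_morphism); intros X; rewrite IHa.
    replace (fun Y => scons X w (scons 0 (fun n => S (r n)) Y))
      with (scons X (fun Y => w (r Y))); [reflexivity|].
    now extensionality n; destruct n.
Qed.

Lemma subst_BAllNum s r t a :
  subst s r (BAllNum t a) = BAllNum (tsubst s t) (subst (up s) r a).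
Proof.
  unfold BAllNum; cbn; fold (up s).
  unfold tshift; rewrite !tsubst_comp; reflexivity.
Qed.

Lemma subst_BExNum s r t a :
  subst s r (BExNum t a) = BExNum (tsubst s t) (subst (up s) r a).
Proof.
  unfold BExNum; cbn; fold (up s).
  unfold tshift; rewrite !tsubst_comp; reflexivity.
Qed.

Lemma Delta00_subst a : Delta00 a -> forall s r, Delta00 (subst s r a).
Proof.
  induction 1; intros s' r; rewrite ?subst_BAllNum, ?subst_BExNum; cbn [subst];
    first [now apply D_bex | now apply D_ball | constructor; auto].
Qed.

Section Definability.
Context {M : structure} (w : nat -> sets M).

Definition is_term (f : (nat -> num M) -> num M) : Prop :=
  exists t, forall v, eval v t = f v.

Definition bounded (A : (nat -> num M) -> Prop) : Prop :=
  exists b, Delta00 b /\ forall v, sat v w b <-> A v.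

(* Predicates depend on an environment, so that the bound variable of a
   quantifier becomes entry 0 of the environment once the quantifier is removed. *)
Definition sigma (A : (nat -> num M) -> Prop) : Prop :=
  exists B : num M -> (nat -> num M) -> Prop,
    bounded (fun v => B (v 0) (fun n => v (S n)))
    /\ forall v, A v <-> exists x, B x v.

Lemma tm_var n : is_term (fun v => v n).
Proof. now exists (tvar n). Qed.

Lemma tm_zero : is_term (fun _ => zero).
Proof. now exists tzero. Qed.

Lemma tm_one : is_term (fun _ => one).
Proof. now exists tone. Qed.

Lemma tm_add f g : is_term f -> is_term g -> is_term (fun v => add (f v) (g v)).
Proof. intros [s Hs] [t Ht]; exists (tadd s t); intros v; cbn; congruence. Qed.

Lemma tm_mul f g : is_term f -> is_term g -> is_term (fun v => mul (f v) (g v)).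
Proof. intros [s Hs] [t Ht]; exists (tmul s t); intros v; cbn; congruence. Qed.

Lemma bd_eq f g : is_term f -> is_term g -> bounded (fun v => f v = g v).
Proof.
  intros [s Hs] [t Ht]; exists (EqNum s t); split; [constructor|].
  intros v; cbn; now rewrite Hs, Ht.
Qed.

Lemma bd_lt f g : is_term f -> is_term g -> bounded (fun v => lt (f v) (g v)).
Proof.
  intros [s Hs] [t Ht]; exists (LtNum s t); split; [constructor|].
  intros v; cbn; now rewrite Hs, Ht.
Qed.

Lemma bd_mem f k : is_term f -> bounded (fun v => mem (f v) (w k)).
Proof.
  intros [s Hs]; exists (MemSet s k); split; [constructor|].
  intros v; cbn; now rewrite Hs.
Qed.

Lemma bd_imp A B : bounded A -> bounded B -> bounded (fun v => A v -> B v).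
Proof.
  intros [a [Ha HA]] [b [Hb HB]]; exists (Imp a b); split; [now constructor|].
  intros v; cbn; now rewrite HA, HB.
Qed.

Lemma bd_not A : bounded A -> bounded (fun v => ~ A v).
Proof.
  intros H; apply bd_imp; [exact H|].
  exists Bot; split; [constructor | reflexivity].
Qed.

Lemma bd_ext A B : (forall v, A v <-> B v) -> bounded A -> bounded B.
Proof.
  intros E [a [Ha HA]]; exists a; split; [exact Ha|]. intros v; now rewrite HA.
Qed.

Lemma bd_and A B : bounded A -> bounded B -> bounded (fun v => A v /\ B v).
Proof.
  intros HA HB; apply bd_ext with (fun v => ~ (A v -> ~ B v)); [intros; tauto|].
  apply bd_not, bd_imp, bd_not; assumption.
Qed.

Lemma bd_or A B : bounded A -> bounded B -> bounded (fun v => A v \/ B v).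
Proof.
  intros HA HB; apply bd_ext with (fun v => ~ A v -> B v); [intros; tauto|].
  apply bd_imp, HB; now apply bd_not.
Qed.

Lemma bd_all f (A : num M -> (nat -> num M) -> Prop) :
  is_term f -> bounded (fun v => A (v 0) (fun n => v (S n))) ->
  bounded (fun v => forall x, lt x (f v) -> A x v).
Proof.
  intros [t Ht] [a [Ha HA]]; exists (BAllNum t a); split; [now constructor|].
  intros v; cbn; apply Morphisms_Prop.all_iff_morphism; intros x.
  rewrite eval_tshift, Ht, HA; reflexivity.
Qed.

Lemma bd_ex f (A : num M -> (nat -> num M) -> Prop) :
  is_term f -> bounded (fun v => A (v 0) (fun n => v (S n))) ->
  bounded (fun v => exists x, lt x (f v) /\ A x v).
Proof.
  intros [t Ht] [a [Ha HA]]; exists (BExNum t a); split; [now apply D_bex|].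
  intros v; unfold BExNum; rewrite sat_exN.
  apply Morphisms_Prop.ex_iff_morphism; intros x.
  rewrite sat_and; cbn [sat]; rewrite eval_tshift, Ht, HA; reflexivity.
Qed.

Lemma bd_rename (f : nat -> nat) A :
  bounded A -> bounded (fun v => A (fun n => v (f n))).
Proof.
  intros [a [Ha HA]]; exists (subst (fun n => tvar (f n)) (fun X => X) a); split.
  - now apply Delta00_subst.
  - intros v; rewrite sat_subst; apply HA.
Qed.

Lemma sigma_bounded A : bounded A -> sigma A.
Proof.
  intros H; exists (fun _ v => A v); split; [exact (bd_rename S A H)|].
  intros v; split; [intros; now exists zero | now intros []].
Qed.

(** This is the form of existential closure usable before the order is developed; [sigma_ex], which
    merges quantifiers, relies on [lt_def]. *)
Lemma sigma_ex_bounded (A : num M -> (nat -> num M) -> Prop) :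
  bounded (fun v => A (v 0) (fun n => v (S n))) -> sigma (fun v => exists x, A x v).
Proof. intros H; exists A; split; [exact H | reflexivity]. Qed.

End Definability.

Ltac solve_term :=
  solve [repeat first [apply tm_add | apply tm_mul | apply tm_zero | apply tm_one
                      | apply tm_var]].

Ltac solve_bounded :=
  cbv beta;
  solve [repeat first [apply bd_and | apply bd_or | apply bd_not | apply bd_ex
                      | apply bd_all | apply bd_eq | apply bd_lt | apply bd_imp
                      | solve_term | assumption]].

(** * Arithmetic in models of RCA0 *)

Declare Scope num_scope.
Delimit Scope num_scope with num.
Bind Scope num_scope with num.
Notation "0" := zero : num_scope.
Notation "1" := one : num_scope.
Infix "+" := add : num_scope.
Infix "*" := mul : num_scope.
Infix "<" := lt : num_scope.

Section Arithmetic.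
Context {M : structure} (HM : models M RCA0) (w : nat -> sets M).
Local Open Scope num_scope.
Implicit Types x y z : num M.

Lemma succ_neq0 x : x + 1 <> 0.
Proof. exact (HM _ ax_succ_neq0 (fun _ => x) w). Qed.

Lemma succ_inj x y : x + 1 = y + 1 -> x = y.
Proof. exact (HM _ ax_succ_inj (scons x (fun _ => y)) w). Qed.

Lemma addx0 x : x + 0 = x.
Proof. exact (HM _ ax_add0 (fun _ => x) w). Qed.

Lemma addxS x y : x + (y + 1) = x + y + 1.
Proof. exact (HM _ ax_addS (scons x (fun _ => y)) w). Qed.

Lemma mulx0 x : x * 0 = 0.
Proof. exact (HM _ ax_mul0 (fun _ => x) w). Qed.

Lemma mulxS x y : x * (y + 1) = x * y + x.
Proof. exact (HM _ ax_mulS (scons x (fun _ => y)) w). Qed.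

Lemma not_lt0 x : ~ x < 0.
Proof. exact (HM _ ax_lt0 (fun _ => x) w). Qed.

Lemma lt_succ x y : x < y + 1 <-> x < y \/ x = y.
Proof.
  pose proof (HM _ ax_ltS (scons x (fun _ => y)) w) as H.
  rewrite sat_iff, sat_or in H; exact H.
Qed.

Lemma sigma_induction (P : num M -> (nat -> num M) -> Prop) :
  sigma w (fun v => P (v 0%nat) (fun n => v (S n))) ->
  forall v, P 0 v -> (forall x, P x v -> P (x + 1) v) -> forall x, P x v.
Proof.
  intros [B [[b [Hb HB]] HP]] v H0 HS.
  assert (E : forall x, sat (scons x v) w (ExNum b) <-> P x v).
  { intros x; rewrite sat_exN, (HP (scons x v)).
    apply Morphisms_Prop.ex_iff_morphism; intros y; apply HB. }
  assert (S : Sigma01 (ExNum b)) by now exists b.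
  pose proof (HM _ (ax_induction _ S) v w) as H.
  assert (C : forall x, sat (scons x v) w (ExNum b)).
  { apply H; clear H; apply sat_and; split.
    - unfold instN; rewrite sat_subst.
      replace (fun n => _) with (scons 0 v) by now extensionality n; destruct n.
      now apply E.
    - intros x Hx; unfold succ_inst; rewrite sat_subst.
      replace (fun n => _) with (scons (x + 1) v) by now extensionality n; destruct n.
      apply E, HS, E, Hx. }
  intros x; apply E, C.
Qed.

Lemma bounded_induction (P : num M -> (nat -> num M) -> Prop) :
  bounded w (fun v => P (v 0%nat) (fun n => v (S n))) ->
  forall v, P 0 v -> (forall x, P x v -> P (x + 1) v) -> forall x, P x v.
Proof. intros H; apply sigma_induction, sigma_bounded, H. Qed.

(** Induction applies to predicates of environments, so the parameters [x] and [y] are read from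
    entries 0 and 1. The proofs below follow the same pattern. *)
Lemma addA x y z : x + (y + z) = x + y + z.
Proof.
  refine (bounded_induction (fun z v => v 0%nat + (v 1%nat + z) = v 0%nat + v 1%nat + z) _
    (scons x (fun _ => y)) _ _ z).
  - solve_bounded.
  - now rewrite !addx0.
  - intros t Ht; cbn in *; now rewrite !addxS, Ht.
Qed.

Lemma add0x x : 0 + x = x.
Proof.
  refine (bounded_induction (fun z v => 0 + z = z) _
    (fun _ => x) _ _ x).
  - solve_bounded.
  - apply addx0.
  - intros t Ht; now rewrite addxS, Ht.
Qed.

Lemma add1x x : 1 + x = x + 1.
Proof.
  refine (bounded_induction (fun z v => 1 + z = z + 1) _
    (fun _ => x) _ _ x).
  - solve_bounded.
  - now rewrite addx0, add0x.
  - intros t Ht; now rewrite addxS, Ht.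
Qed.

Lemma addC x y : x + y = y + x.
Proof.
  refine (bounded_induction (fun z v => v 0%nat + z = z + v 0%nat) _
    (fun _ => x) _ _ y).
  - solve_bounded.
  - now rewrite addx0, add0x.
  - intros t Ht; cbn in *; now rewrite addxS, Ht, <- addxS, <- add1x, addA.
Qed.

Lemma mul0x x : 0 * x = 0.
Proof.
  refine (bounded_induction (fun z v => 0 * z = 0) _
    (fun _ => x) _ _ x).
  - solve_bounded.
  - apply mulx0.
  - intros t Ht; now rewrite mulxS, Ht, addx0.
Qed.

Lemma mulDl x y z : (x + y) * z = x * z + y * z.
Proof.
  refine (bounded_induction (fun z v => (v 0%nat + v 1%nat) * z = v 0%nat * z + v 1%nat * z) _
    (scons x (fun _ => y)) _ _ z).
  - solve_bounded.
  - now rewrite !mulx0, addx0.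
  - intros t Ht; cbn in *; rewrite !mulxS, Ht, <- !addA; f_equal.
    rewrite !addA; f_equal; apply addC.
Qed.

Lemma mul1x x : 1 * x = x.
Proof.
  refine (bounded_induction (fun z v => 1 * z = z) _
    (fun _ => x) _ _ x).
  - solve_bounded.
  - apply mulx0.
  - intros t Ht; now rewrite mulxS, Ht.
Qed.

Lemma mulC x y : x * y = y * x.
Proof.
  refine (bounded_induction (fun z v => v 0%nat * z = z * v 0%nat) _
    (fun _ => x) _ _ y).
  - solve_bounded.
  - now rewrite mulx0, mul0x.
  - intros t Ht; cbn in *; now rewrite mulxS, Ht, mulDl, mul1x.
Qed.

Lemma mulA x y z : x * (y * z) = x * y * z.
Proof.
  refine (bounded_induction (fun z v => v 0%nat * (v 1%nat * z) = v 0%nat * v 1%nat * z) _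
    (scons x (fun _ => y)) _ _ z).
  - solve_bounded.
  - now rewrite !mulx0.
  - intros t Ht; cbn in *. rewrite !mulxS, <- Ht, (mulC x (_ + _)), mulDl.
    now rewrite (mulC _ x), (mulC y x).
Qed.

Lemma num_semi_ring : semi_ring_theory 0 1 add mul (@eq (num M)).
Proof.
  constructor; auto using add0x, addC, addA, mul1x, mul0x, mulC, mulA, mulDl.
Qed.

Add Ring num_ring : num_semi_ring.

Lemma addI x y z : x + z = y + z -> x = y.
Proof.
  revert z; refine (bounded_induction
    (fun z v => v 0%nat + z = v 1%nat + z -> v 0%nat = v 1%nat) _
    (scons x (fun _ => y)) _ _).
  - solve_bounded.
  - cbn; now rewrite !addx0.
  - intros t Ht; cbn in *; rewrite !addxS; intros H; apply Ht, succ_inj, H.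
Qed.

Lemma addIl x y z : z + x = z + y -> x = y.
Proof. rewrite !(addC z); apply addI. Qed.

Lemma zero_or_succ x : x = 0 \/ exists y, x = y + 1.
Proof.
  (* The existential quantifier is moved to the front to bring the predicate into the shape required
     for induction. *)
  cut (exists y, x = 0 \/ x = y + 1); [firstorder|].
  refine (sigma_induction (fun x v => exists y, x = 0 \/ x = y + 1) _
    (fun _ => x) _ _ x).
  - apply sigma_ex_bounded; solve_bounded.
  - exists 0; auto.
  - intros t _; exists t; auto.
Qed.

Lemma even_or_odd x : exists y i, (i = 0 \/ i = 1) /\ x = y + y + i.
Proof.
  cut (exists y, x = y + y + 0 \/ x = y + y + 1).
  { intros [y [H|H]]; exists y; eexists; eauto. }
  refine (sigma_induction (fun x v => exists y, x = y + y + 0 \/ x = y + y + 1) _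
    (fun _ => x) _ _ x).
  - apply sigma_ex_bounded; solve_bounded.
  - exists 0; left; ring.
  - intros t [y [->| ->]]; [exists y | exists (y + 1)]; [right|left]; ring.
Qed.

Lemma le_total x y : exists d, y = x + d \/ x = y + d.
Proof.
  revert y; refine (sigma_induction (fun y v => exists d, y = v 0%nat + d \/ v 0%nat = y + d) _
    (fun _ => x) _ _).
  - apply sigma_ex_bounded; solve_bounded.
  - exists x; right; ring.
  - cbn; intros t [d [->|H]].
    + exists (d + 1); left; ring.
    + destruct (zero_or_succ d) as [->|[e ->]].
      * exists 1; left; rewrite H; ring.
      * exists e; right; rewrite H; ring.
Qed.

(** The axioms describe [<] only through successors. This equational form lets [ring] settle order
    facts. *)
Lemma lt_def x y : x < y <-> exists z, y = x + z + 1.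
Proof.
  split.
  - cut (exists z, x < y -> y = x + z + 1); [firstorder|].
    revert y; refine (sigma_induction
      (fun y v => exists z, v 0%nat < y -> y = v 0%nat + z + 1) _
    (fun _ => x) _ _).
    + apply sigma_ex_bounded; solve_bounded.
    + exists 0; intros H; now apply not_lt0 in H.
    + cbn; intros t [z Hz]; destruct (classic (x = t)) as [->|Hn].
      * exists 0; intros _; ring.
      * exists (z + 1); intros [H|H]%lt_succ; [|contradiction].
        rewrite (Hz H) at 1; ring.
  - intros [z ->]; revert z.
    refine (bounded_induction (fun z v => v 0%nat < v 0%nat + z + 1) _
    (fun _ => x) _ _).
    + solve_bounded.
    + apply lt_succ; right; cbn; ring.
    + cbn; intros t Ht; apply lt_succ; left; now rewrite addA.
Qed.

Lemma lt_irrefl x : ~ x < x.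
Proof.
  intros [z H]%lt_def. apply (succ_neq0 z), (addI _ _ x); rewrite H at 2; ring.
Qed.

Lemma lt_trans x y z : x < y -> y < z -> x < z.
Proof.
  intros [a ->]%lt_def [b ->]%lt_def; apply lt_def; exists (a + 1 + b); ring.
Qed.

Lemma lt_trichotomy x y : x < y \/ x = y \/ y < x.
Proof.
  destruct (le_total x y) as [d H]; destruct (zero_or_succ d) as [->|[e ->]].
  - right; left; destruct H as [H|H]; rewrite H; ring.
  - destruct H as [H|H]; [left|right; right]; apply lt_def; exists e; rewrite H; ring.
Qed.

Lemma lt_0_1 : (0 : num M) < 1.
Proof. apply lt_def; exists 0; ring. Qed.

Lemma half_inj x y i j :
  (i = 0 \/ i = 1) -> (j = 0 \/ j = 1) -> x + x + i = y + y + j -> x = y /\ i = j.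
Proof.
  (* If y = x + e + 1, then i = 2e + 2 + j, which is at least 2. *)
  assert (K : forall x y i j, (i = 0 \/ i = 1) -> x < y -> x + x + i <> y + y + j).
  { intros x' y' i' j' Hi [e ->]%lt_def H.
    assert (E : i' = e + e + 1 + j' + 1).
    { apply (addI _ _ (x' + x')). transitivity (x' + x' + i'); [ring|].
      rewrite H; ring. }
    destruct Hi as [->| ->].
    - symmetry in E; now apply succ_neq0 in E.
    - apply (succ_neq0 (e + e + j')), (addI _ _ 1).
      transitivity (e + e + 1 + j' + 1); [ring|]. rewrite <- E; ring. }
  intros Hi Hj H. destruct (lt_trichotomy x y) as [L|[->|L]].
  - now apply (K x y i j) in L.
  - split; [reflexivity|]. now apply addIl in H.
  - symmetry in H; now apply (K y x j i) in L.
Qed.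

Definition pair x y := (x + y) * (x + y) + x.

Lemma tm_pair (f g : (nat -> num M) -> num M) :
  is_term f -> is_term g -> is_term (fun v => pair (f v) (g v)).
Proof. intros; unfold pair; repeat first [assumption | apply tm_add | apply tm_mul]. Qed.

Lemma pair_inj x y x' y' : pair x y = pair x' y' -> x = x' /\ y = y'.
Proof.
  (* If x + y < x' + y', then (x' + y')^2 >= (x + y + 1)^2 > (x + y)^2 + x. *)
  assert (K : forall x y x' y', x + y < x' + y' -> pair x y <> pair x' y').
  { intros a b a' b' [e He]%lt_def H; unfold pair in H; rewrite He in H.
    set (u := a + b) in *.
    (* The successor of this number is the excess of [(u + e + 1)^2 + a'] over [u^2 + a]; one of the
       two copies of [u = a + b] in the expansion absorbs [a] and leaves [b]. *)
    apply (succ_neq0 (b + (u + e * e + (1 + 1) * u * e + e + e) + a')).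
    apply (addI _ _ (u * u + a)). symmetry.
    transitivity (u * u + a); [ring|].
    transitivity ((u + e + 1) * (u + e + 1) + a'); [exact H | unfold u; ring]. }
  intros H. destruct (lt_trichotomy (x + y) (x' + y')) as [L|[E|L]].
  - now apply K in L.
  - unfold pair in H; rewrite E in H.
    apply addIl in H; subst x'; split; [reflexivity | now apply addIl in E].
  - apply K in L; now symmetry in H.
Qed.

(** With these bounds, being no pair code is a bounded condition, as [relation_comprehension] needs.
    The [+ 1] is there because a component can equal the code. *)
Lemma lt_pair_l x y : x < pair x y + 1.
Proof. apply lt_def; exists ((x + y) * (x + y)); unfold pair; ring. Qed.

Lemma lt_pair_r x y : y < pair x y + 1.
Proof.
  apply lt_def; destruct (zero_or_succ y) as [->|[e ->]]; unfold pair.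
  - exists (x * x + x); ring.
  - exists ((x + e) * (x + e) + x + x + e + x); ring.
Qed.

(** * Comprehension *)

Lemma sigma_or (A B : (nat -> num M) -> Prop) :
  sigma w A -> sigma w B -> sigma w (fun v => A v \/ B v).
Proof.
  intros [A' [HA EA]] [B' [HB EB]]; exists (fun x v => A' x v \/ B' x v); split.
  - now apply bd_or.
  - intros v; rewrite EA, EB; firstorder.
Qed.

Lemma bound2 x y : exists z, x < z /\ y < z.
Proof. exists (x + y + 1); split; apply lt_def; eexists; [|rewrite (addC x)]; reflexivity. Qed.

(** A single unbounded [z] lies above both witnesses, which become bounded quantifiers below it. *)
Lemma sigma_and (A B : (nat -> num M) -> Prop) :
  sigma w A -> sigma w B -> sigma w (fun v => A v /\ B v).
Proof.
  intros [A' [HA EA]] [B' [HB EB]].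
  exists (fun z v => (exists x, x < z /\ A' x v) /\ (exists y, y < z /\ B' y v)); split.
  - set (f n := match n with O => O | S n => S (S n) end).
    apply (bd_rename w f) in HA, HB.
    apply bd_and; apply bd_ex; auto; apply tm_var.
  - intros v; rewrite EA, EB; split.
    + intros [[x Hx] [y Hy]]; destruct (bound2 x y) as [z [Hz1 Hz2]].
      exists z; split; [exists x | exists y]; auto.
    + firstorder.
Qed.

Lemma sigma_ex (A : num M -> (nat -> num M) -> Prop) :
  sigma w (fun v => A (v 0%nat) (fun n => v (S n))) -> sigma w (fun v => exists x, A x v).
Proof.
  intros [B [HB EB]].
  exists (fun z v => exists x, x < z /\ exists y, y < z /\ B y (scons x v)); split.
  - apply bd_ex; [apply tm_var|]. apply bd_ex; [apply tm_var|].
    set (f n := match n with O => O | S O => S O | S (S n) => S (S (S n)) end).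
    apply (bd_rename w f) in HB; revert HB; apply bd_ext; intros v.
    replace (fun n => v (f (S n)))
      with (scons (v 1%nat) (fun n => v (S (S (S n))))); [reflexivity|].
    now extensionality n; destruct n.
  - intros v; split.
    + intros [x Hx]; apply (EB (scons x v)) in Hx; destruct Hx as [y Hy].
      destruct (bound2 x y) as [z [Hz1 Hz2]].
      exists z, x; split; [assumption|]; exists y; auto.
    + intros [z [x [_ [y [_ Hy]]]]]; exists x; apply (EB (scons x v)); eauto.
Qed.

(** The axiom wants a Pi01 equivalent of [P]; it is the negated matrix of [Q] under a universal
    quantifier. Parameters enter only as sets through [w], so the number environment is constantly
    zero. *)
Lemma comprehension (P Q : num M -> Prop) :
  sigma w (fun v => P (v 0%nat)) -> sigma w (fun v => Q (v 0%nat)) ->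
  (forall x, P x <-> ~ Q x) -> exists X, forall x, mem x X <-> P x.
Proof.
  intros [A [[a [Ha HA]] EA]] [B [[b [Hb HB]] EB]] HPQ.
  assert (Sa : Sigma01 (ExNum a)) by now exists a.
  assert (Pb : Pi01 (AllNum (Neg b))).
  { exists (Neg b); split; [repeat constructor; auto | reflexivity]. }
  pose (v := fun _ : nat => zero : num M).
  assert (E1 : forall x, sat (scons x v) w (ExNum a) <-> P x).
  { intros x; rewrite sat_exN, (EA (scons x v)).
    apply Morphisms_Prop.ex_iff_morphism; intros y; apply HA. }
  assert (E2 : forall x, sat (scons x v) w (AllNum (Neg b)) <-> ~ Q x).
  { intros x; rewrite (EB (scons x v)); cbn; split.
    - intros H [y Hy]; apply (H y), HB, Hy.
    - intros H y Hy; apply H; exists y; apply HB in Hy; exact Hy. }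
  pose proof (HM _ (ax_comprehension _ _ Sa Pb) v w) as H.
  match type of H with sat _ _ (Imp ?p ?q) => change (sat v w p -> sat v w q) in H end.
  rewrite sat_exS in H; destruct H as [X HX].
  - change (forall x, sat (scons x v) w (Iff (ExNum a) (AllNum (Neg b)))).
    intros x; rewrite sat_iff, E1, E2; apply HPQ.
  - exists X; intros x.
    change (forall x, sat (scons x v) (scons X w)
              (Iff (MemSet (tvar 0) 0%nat) (shiftS (ExNum a)))) in HX.
    specialize (HX x); unfold shiftS in HX; rewrite sat_iff, sat_subst in HX.
    rewrite <- E1; exact HX.
Qed.

(** A number lies outside the relation if it codes no pair, which is bounded, or codes a pair
    related by [Q]. The last conclusion is what [subset_prod_in] will ask for. *)
Lemma relation_comprehension (P Q : num M -> num M -> Prop) :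
  sigma w (fun v => P (v 0%nat) (v 1%nat)) -> sigma w (fun v => Q (v 0%nat) (v 1%nat)) ->
  (forall x y, P x y <-> ~ Q x y) ->
  exists X, (forall x y, mem (pair x y) X <-> P x y)
    /\ forall c, mem c X -> exists x y, c = pair x y /\ P x y.
Proof.
  assert (K : forall P : num M -> num M -> Prop,
    sigma w (fun v => P (v 0%nat) (v 1%nat)) ->
    sigma w (fun v => exists x y, v 0%nat = pair x y /\ P x y)).
  { intros R [B [HB EB]]; do 2 apply sigma_ex; apply sigma_and.
    - apply sigma_bounded, bd_eq; [apply tm_var|]. apply tm_pair; apply tm_var.
    (* The inner quantifier binds [y] at entry 0 and the outer one [x] at entry 1, so the two
       arguments of [R] are swapped. *)
    - pose (f n := match n with O => 1%nat | S O => O | _ => 2%nat end).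
      exists (fun x v => B x (fun n => v (f n))); split.
      + exact (bd_rename w (fun n => match n with O => O | S n => S (f n) end) _ HB).
      + intros v; exact (EB (fun n => v (f n))). }
  intros HP HQ HPQ.
  destruct (comprehension (fun c => exists x y, c = pair x y /\ P x y)
    (fun c => (forall x, x < c + 1 -> forall y, y < c + 1 -> c <> pair x y)
              \/ exists x y, c = pair x y /\ Q x y)) as [X HX].
  - now apply K.
  - apply sigma_or; [|now apply K]. apply sigma_bounded.
    repeat (apply bd_all; [solve_term|]). apply bd_not, bd_eq; [apply tm_var|].
    apply tm_pair; apply tm_var.
  - intros c; split.
    + intros [x [y [-> Hxy]]] [H|[x' [y' [E H]]]].
      * apply (H x) with (y := y); auto using lt_pair_l, lt_pair_r.
      * apply pair_inj in E; destruct E as [<- <-]; now apply HPQ in Hxy.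
    + intros H; apply not_or_and in H; destruct H as [H1 H2].
      apply NNPP; intros H; apply H1; intros x _ y _ ->.
      apply H; exists x, y; split; [reflexivity|]. apply HPQ; intros K'; eauto.
  - exists X; split.
    + intros x y; rewrite HX; split; [|eauto].
      intros [x' [y' [E H]]]; apply pair_inj in E; now destruct E as [<- <-].
    + intros c Hc; now apply HX.
Qed.

End Arithmetic.
(** * Interval orders in models of RCA0 *)

Section IntervalOrders.
Context {M : structure}.
Implicit Types X Y A B F G P L R : sets M.

Definition rel R (x y : num M) : Prop := mem (pair x y) R.

(** These definitions copy the formulas connective by connective, so that the translations below
    reduce to [reflexivity] at the atoms. *)
Definition subset_prod_in X A B : Prop :=
  forall c, mem c X -> exists a b, mem a A /\ mem b B /\ c = pair a b.

Definition partial_order_in P R : Prop :=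
  subset_prod_in R P P
  /\ (forall x, mem x P -> rel R x x)
  /\ (forall x y z, rel R x y -> rel R y z -> rel R x z)
  /\ (forall x y, rel R x y -> rel R y x -> x = y).

Definition linear_order_in L R : Prop :=
  partial_order_in L R
  /\ forall x y, mem x L -> mem y L -> rel R x y \/ rel R y x.

Definition function_in F A B : Prop :=
  subset_prod_in F A B
  /\ forall x, mem x A -> exists y, rel F x y /\ forall z, rel F x z -> z = y.

Definition c1_in P R F G : Prop :=
  forall p, mem p P -> exists a b, rel F p a /\ rel G p b /\ rel R a b.

Definition c2_in P S R F G : Prop :=
  forall p q, mem p P -> mem q P ->
    ((rel S p q /\ p <> q)
     <-> exists a b, rel G p a /\ rel F q b /\ (rel R a b /\ a <> b)).

Definition c4_in P F G : Prop :=
  forall (i j : bool) p q, mem p P -> mem q P -> p <> q \/ i <> j ->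
    exists a b, rel (if i then G else F) p a /\ rel (if j then G else F) q b /\ a <> b.

Definition interval_rep_in P S L R F G : Prop :=
  linear_order_in L R /\ function_in F P L /\ function_in G P L
  /\ c1_in P R F G /\ c2_in P S R F G.

End IntervalOrders.

(** * Translation of the formulas into statements about the model *)

Lemma imp_iff_compat (A B A' B' : Prop) :
  (A <-> A') -> (B <-> B') -> ((A -> B) <-> (A' -> B')).
Proof. tauto. Qed.

Lemma iff_iff_compat (A B A' B' : Prop) :
  (A <-> A') -> (B <-> B') -> ((A <-> B) <-> (A' <-> B')).
Proof. tauto. Qed.

Ltac unfold_sat :=
  repeat lazymatch goal with
  | |- sat _ _ (And _ _) <-> _ => rewrite sat_and; apply Morphisms_Prop.and_iff_morphism
  | |- sat _ _ (Or _ _) <-> _ => rewrite sat_or; apply Morphisms_Prop.or_iff_morphism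
  | |- sat _ _ (Iff _ _) <-> _ => rewrite sat_iff; apply iff_iff_compat
  | |- sat _ _ (Neg _) <-> _ => rewrite sat_neg; apply not_iff_compat
  | |- sat _ _ (ExNum _) <-> _ =>
      rewrite sat_exN; apply Morphisms_Prop.ex_iff_morphism; intros ?
  | |- sat _ _ (AllNum _) <-> _ =>
      rewrite sat_allN; apply Morphisms_Prop.all_iff_morphism; intros ?
  | |- sat _ _ (Imp _ _) <-> _ => rewrite sat_imp; apply imp_iff_compat
  | |- _ => reflexivity
  end.

Section Translation.
Context {M : structure} (v : nat -> num M) (w : nat -> sets M).

Lemma sat_subset_prod X A B :
  sat v w (subset_prod X A B) <-> subset_prod_in (w X) (w A) (w B).
Proof. unfold subset_prod; unfold_sat. Qed.

Lemma sat_partial_order P R :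
  sat v w (partial_order P R) <-> partial_order_in (w P) (w R).
Proof. unfold partial_order; rewrite !sat_and, sat_subset_prod; reflexivity. Qed.

Lemma sat_linear_order L R :
  sat v w (linear_order L R) <-> linear_order_in (w L) (w R).
Proof.
  unfold linear_order; rewrite sat_and, sat_partial_order.
  apply and_iff_compat_l; unfold_sat.
Qed.

Lemma sat_is_function F A B :
  sat v w (is_function F A B) <-> function_in (w F) (w A) (w B).
Proof.
  unfold is_function; rewrite sat_and, sat_subset_prod.
  apply and_iff_compat_l; unfold_sat.
Qed.

Lemma sat_c1 P R F G :
  sat v w (c1 P R F G) <-> c1_in (w P) (w R) (w F) (w G).
Proof. unfold c1, with_values; unfold_sat. Qed.

Lemma sat_c2 P S R F G :
  sat v w (c2 P S R F G) <-> c2_in (w P) (w S) (w R) (w F) (w G).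
Proof. unfold c2, with_values, instrict; unfold_sat. Qed.

(** The formula compares numerals where the translation compares booleans; these agree once 0 and 1
    differ in the model. *)
Lemma sat_c4_at P F G i j :
  (zero : num M) <> one ->
  sat v w (c4_at P F G i j) <->
  forall p q, mem p (w P) -> mem q (w P) -> p <> q \/ i <> j ->
    exists a b, rel (if i then w G else w F) p a
      /\ rel (if j then w G else w F) q b /\ a <> b.
Proof.
  intros H01; unfold c4_at, with_values.
  do 2 (rewrite sat_allN; apply Morphisms_Prop.all_iff_morphism; intros ?).
  do 2 (rewrite sat_imp; apply imp_iff_compat; [reflexivity|]).
  rewrite sat_imp; apply imp_iff_compat.
  - rewrite sat_or; destruct i, j; cbn; intuition congruence.
  - unfold_sat; destruct i, j; reflexivity.
Qed.

Lemma sat_c4 P F G :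
  (zero : num M) <> one -> c4_in (w P) (w F) (w G) -> sat v w (c4 P F G).
Proof.
  intros H01 H; unfold c4; rewrite !sat_and.
  repeat split; apply sat_c4_at; auto; apply H.
Qed.

Lemma sat_interval_rep P S L R F G :
  sat v w (interval_rep P S L R F G)
  <-> interval_rep_in (w P) (w S) (w L) (w R) (w F) (w G).
Proof.
  unfold interval_rep.
  rewrite !sat_and, sat_linear_order, !sat_is_function, sat_c1, sat_c2; reflexivity.
Qed.

End Translation.

(** * The distinguishing representation *)

Section Distinguishing.
Context {M : structure} (HM : models M RCA0) (P S L R F G : sets M).
Context (HI : interval_rep_in P S L R F G).
Local Open Scope num_scope.

(** The set parameters get indices 0 to 3, which [bd_memP], [bd_relR], [bd_relF] and [bd_relG] refer
    to. *)
Let w : nat -> sets M := scons P (scons R (scons F (fun _ => G))).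

Let HL : linear_order_in L R := proj1 HI.
Let HF : function_in F P L := proj1 (proj2 HI).
Let HG : function_in G P L := proj1 (proj2 (proj2 HI)).

Lemma rel_dom (X A B : sets M) x y :
  subset_prod_in X A B -> rel X x y -> mem x A /\ mem y B.
Proof.
  intros H Hxy; destruct (H _ Hxy) as [a [b [Ha [Hb E]]]].
  apply (pair_inj HM w) in E; destruct E as [-> ->]; auto.
Qed.

Lemma function_unique (X A B : sets M) x y z :
  function_in X A B -> rel X x y -> rel X x z -> y = z.
Proof.
  intros [H1 H2] Hy Hz; pose proof (rel_dom _ _ _ _ _ H1 Hy) as [Hx _].
  destruct (H2 x Hx) as [t [_ Ht]]; rewrite (Ht y Hy); symmetry; auto.
Qed.

(* [n] is the endpoint number [i] (left if 0, right if 1) of [p], and [x] is its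
   value in the given representation. *)
Definition point (n p i x : num M) : Prop :=
  n = p + p + i /\ mem p P /\ ((i = 0 /\ rel F p x) \/ (i = 1 /\ rel G p x)).

(** The side is compared before the element, so at a common value all left endpoints precede all
    right ones; [p] and [q] only break ties between endpoints on the same side. *)
Definition lex (x i p y j q : num M) : Prop :=
  (rel R x y /\ x <> y) \/ (x = y /\ (i < j \/ (i = j /\ p < q))).

Definition point_lt (m n : num M) : Prop :=
  exists p i x q j y, point m p i x /\ point n q j y /\ lex x i p y j q.

Definition is_point (n : num M) : Prop := exists p i x, point n p i x.

(** A Sigma01 form of the complement of [is_point], as comprehension demands; [even_or_odd] makes it
    exhaustive. *)
Definition no_point (n : num M) : Prop :=
  exists p i, n = p + p + i /\ (i = 0 \/ i = 1) /\ ~ mem p P.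

Definition point_le (m n : num M) : Prop := (m = n /\ is_point m) \/ point_lt m n.

Lemma point_unique n p i x q j y :
  point n p i x -> point n q j y -> p = q /\ i = j /\ x = y.
Proof.
  intros [-> [Hp H1]] [E [Hq H2]].
  apply (half_inj HM w) in E; [|tauto|tauto]; destruct E as [<- <-].
  split; [reflexivity|]; split; [reflexivity|].
  pose proof (succ_neq0 HM w 0%num) as H01; rewrite (add0x HM w) in H01.
  destruct H1 as [[-> H1]|[-> H1]], H2 as [[E H2]|[E H2]].
  - exact (function_unique _ _ _ _ _ _ HF H1 H2).
  - now symmetry in E.
  - contradiction.
  - exact (function_unique _ _ _ _ _ _ HG H1 H2).
Qed.

Lemma point_value n p i x : point n p i x -> mem x L.
Proof.
  intros [_ [_ [[_ H]|[_ H]]]];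
    [apply (rel_dom _ _ _ _ _ (proj1 HF) H) | apply (rel_dom _ _ _ _ _ (proj1 HG) H)].
Qed.

Lemma point_exists p i :
  mem p P -> i = 0 \/ i = 1 -> exists x, point (p + p + i) p i x.
Proof.
  intros Hp [->| ->].
  - destruct (proj2 HF p Hp) as [x [Hx _]]; exists x; repeat split; auto.
  - destruct (proj2 HG p Hp) as [x [Hx _]]; exists x; repeat split; auto.
Qed.

Lemma is_point_iff n : is_point n <-> ~ no_point n.
Proof.
  split.
  - intros [p [i [x [-> [Hp Hi]]]]] [q [j [E [Hj Hq]]]].
    apply (half_inj HM w) in E; [|tauto|tauto]; destruct E as [<- _]; auto.
  - intros H; destruct (even_or_odd HM w n) as [p [i [Hi ->]]].
    assert (Hp : mem p P) by (apply NNPP; intros Hp; apply H; exists p, i; auto).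
    destruct (point_exists p i Hp Hi) as [x Hx]; exists p, i, x; auto.
Qed.

Lemma lex_trans x i p y j q z k r :
  lex x i p y j q -> lex y j q z k r -> lex x i p z k r.
Proof.
  destruct HL as [[_ [_ [Htr Has]]] _].
  intros [[H1 N1]|[-> H1]] [[H2 N2]|[-> H2]].
  (* Two strict steps: if the outer values coincided, antisymmetry would make the middle one equal
     to them. *)
  - left; split; [eauto|]. intros ->; auto.
  - left; auto.
  - left; auto.
  - right; split; [reflexivity|].
    destruct H1 as [H1|[-> H1]], H2 as [H2|[-> H2]]; eauto using lt_trans.
Qed.

Lemma lex_irrefl x i p : ~ lex x i p x i p.
Proof.
  intros [[_ H]|[_ [H|[_ H]]]]; [auto|apply (lt_irrefl HM w) in H ..]; auto.
Qed.

Lemma lex_total x i p y j q : mem x L -> mem y L ->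
  lex x i p y j q \/ (x = y /\ i = j /\ p = q) \/ lex y j q x i p.
Proof.
  intros Hx Hy; destruct (classic (x = y)) as [->|N].
  - unfold lex; destruct (lt_trichotomy HM w i j) as [H|[->|H]]; [tauto| |tauto].
    destruct (lt_trichotomy HM w p q) as [H|[->|H]]; tauto.
  - unfold lex; destruct (proj2 HL x y Hx Hy) as [H|H]; auto 6.
Qed.

Lemma point_lt_trans l m n : point_lt l m -> point_lt m n -> point_lt l n.
Proof.
  intros [p [i [x [q [j [y [H1 [H2 H3]]]]]]]] [q' [j' [y' [r [k [z [H4 [H5 H6]]]]]]]].
  destruct (point_unique _ _ _ _ _ _ _ H2 H4) as [<- [<- <-]].
  exists p, i, x, r, k, z; eauto using lex_trans.
Qed.

Lemma point_lt_irrefl n : ~ point_lt n n.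
Proof.
  intros [p [i [x [q [j [y [H1 [H2 H3]]]]]]]].
  destruct (point_unique _ _ _ _ _ _ _ H1 H2) as [<- [<- <-]].
  now apply lex_irrefl in H3.
Qed.

Lemma point_lt_dom m n : point_lt m n -> is_point m /\ is_point n.
Proof.
  intros [p [i [x [q [j [y [H1 [H2 H3]]]]]]]]; split; unfold is_point; eauto.
Qed.

Lemma point_lt_total m n :
  is_point m -> is_point n -> point_lt m n \/ m = n \/ point_lt n m.
Proof.
  intros [p [i [x Hm]]] [q [j [y Hn]]].
  destruct (lex_total x i p y j q) as [H|[[-> [-> ->]]|H]].
  - eapply point_value, Hm.
  - eapply point_value, Hn.
  - left; exists p, i, x, q, j, y; auto.
  - right; left. destruct Hm as [-> _], Hn as [-> _]; reflexivity.
  - right; right; exists q, j, y, p, i, x; auto.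
Qed.

(** Totality on points turns a failure of [point_le] into a strict comparison the other way, so what
    is negated on the right is again Sigma01. *)
Lemma point_le_compl m n :
  point_le m n <-> ~ ((no_point m \/ no_point n) \/ point_lt n m).
Proof.
  split.
  - intros [[-> H]|H] [[K|K]|K].
    + now apply is_point_iff in H.
    + now apply is_point_iff in H.
    + now apply point_lt_irrefl in K.
    + apply point_lt_dom in H; destruct H as [H _]; now apply is_point_iff in H.
    + apply point_lt_dom in H; destruct H as [_ H]; now apply is_point_iff in H.
    + now apply (point_lt_irrefl m), (point_lt_trans m n m).
  - intros H.
    assert (Hm : is_point m) by (apply is_point_iff; tauto).
    assert (Hn : is_point n) by (apply is_point_iff; tauto).
    unfold point_le; destruct (point_lt_total m n Hm Hn) as [K|[K|K]]; tauto.
Qed.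

Lemma bd_memP f : is_term f -> bounded w (fun v => mem (f v) P).
Proof. exact (bd_mem w f 0%nat). Qed.

Lemma bd_relR f g : is_term f -> is_term g -> bounded w (fun v => rel R (f v) (g v)).
Proof. intros; apply (bd_mem w (fun v => pair (f v) (g v)) 1%nat), tm_pair; auto. Qed.

Lemma bd_relF f g : is_term f -> is_term g -> bounded w (fun v => rel F (f v) (g v)).
Proof. intros; apply (bd_mem w (fun v => pair (f v) (g v)) 2%nat), tm_pair; auto. Qed.

Lemma bd_relG f g : is_term f -> is_term g -> bounded w (fun v => rel G (f v) (g v)).
Proof. intros; apply (bd_mem w (fun v => pair (f v) (g v)) 3%nat), tm_pair; auto. Qed.

Ltac solve_sigma :=
  cbv beta; repeat (apply (sigma_ex HM w); cbv beta);
  apply sigma_bounded; cbv beta;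
  solve [repeat first [apply bd_and | apply bd_or | apply bd_not
                      | apply bd_memP | apply bd_relR | apply bd_relF | apply bd_relG
                      | apply bd_eq | apply bd_lt | solve_term]].

Lemma sigma_is_point k : sigma w (fun v => is_point (v k)).
Proof. unfold is_point, point; solve_sigma. Qed.

Lemma sigma_no_point k : sigma w (fun v => no_point (v k)).
Proof. unfold no_point; solve_sigma. Qed.

Lemma sigma_point_lt k l : sigma w (fun v => point_lt (v k) (v l)).
Proof. unfold point_lt, point, lex; solve_sigma. Qed.

Lemma points_exist : exists L' : sets M, forall n, mem n L' <-> is_point n.
Proof.
  apply (comprehension HM w is_point no_point).
  - apply sigma_is_point.
  - apply sigma_no_point.
  - apply is_point_iff.
Qed.

Lemma point_le_exists : exists R' : sets M,
  (forall m n, rel R' m n <-> point_le m n)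
  /\ forall c, mem c R' -> exists m n, c = pair m n /\ point_le m n.
Proof.
  apply (relation_comprehension HM w point_le
    (fun m n => (no_point m \/ no_point n) \/ point_lt n m)).
  - apply sigma_or; [apply (sigma_and HM)|apply sigma_point_lt].
    + apply sigma_bounded, bd_eq; apply tm_var.
    + apply sigma_is_point.
  - apply sigma_or; [apply sigma_or|apply sigma_point_lt]; apply sigma_no_point.
  - apply point_le_compl.
Qed.

(** The graph of the new endpoint function is bounded, so its plain negation serves as the Sigma01
    complement. *)
Lemma endpoint_exists f : is_term (fun _ => f) -> exists F' : sets M,
  (forall p n, rel F' p n <-> mem p P /\ n = p + p + f)
  /\ forall c, mem c F' -> exists p n, c = pair p n /\ (mem p P /\ n = p + p + f).
Proof.
  intros Hf; apply (relation_comprehension HM w (fun p n => mem p P /\ n = p + p + f)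
    (fun p n => ~ (mem p P /\ n = p + p + f))).
  - apply sigma_bounded, bd_and; [apply bd_memP, tm_var|].
    apply bd_eq; [apply tm_var|]. apply tm_add; [solve_term|exact Hf].
  - apply sigma_bounded, bd_not, bd_and; [apply bd_memP, tm_var|].
    apply bd_eq; [apply tm_var|]. apply tm_add; [solve_term|exact Hf].
  - intros; tauto.
Qed.

Lemma distinguishing_rep :
  exists L' R' F' G', interval_rep_in P S L' R' F' G' /\ c4_in P F' G'.
Proof.
  destruct points_exist as [L' HL'], point_le_exists as [R' [HR' KR']].
  destruct (endpoint_exists 0 tm_zero) as [F' [HF' KF']].
  destruct (endpoint_exists 1 tm_one) as [G' [HG' KG']].
  pose proof (succ_neq0 HM w 0%num) as H01; rewrite (add0x HM w) in H01.
  destruct (proj2 (proj2 (proj2 HI))) as [H1 H2].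
  assert (Hpt : forall p i, mem p P -> i = 0 \/ i = 1 -> mem (p + p + i) L').
  { intros p i Hp Hi; apply HL'; destruct (point_exists p i Hp Hi) as [x Hx].
    exists p, i, x; exact Hx. }
  assert (Hfun : forall (X : sets M) i, i = 0 \/ i = 1 ->
    (forall p n, rel X p n <-> mem p P /\ n = p + p + i) ->
    (forall c, mem c X -> exists p n, c = pair p n /\ (mem p P /\ n = p + p + i)) ->
    function_in X P L').
  { intros X i Hi HX KX; split.
    - intros c Hc; destruct (KX c Hc) as [p [n [-> [Hp ->]]]].
      exists p, (p + p + i); auto.
    - intros p Hp; exists (p + p + i); split; [apply HX; auto|].
      intros n Hn; apply HX in Hn; apply Hn. }
  exists L', R', F', G'; split; [split; [split; [split|]|split; [|split; [|split]]]|].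
  - intros c Hc; destruct (KR' c Hc) as [m [n [-> H]]]; exists m, n.
    rewrite !HL'; destruct H as [[<- H]|H]; [|apply point_lt_dom in H]; tauto.
  - split; [|split].
    + intros n Hn; apply HR'; left; split; [reflexivity | now apply HL'].
    + intros l m n; rewrite !HR'; intros [[-> K1]|K1] [[-> K2]|K2].
      * left; auto.
      * right; auto.
      * right; auto.
      * right; eapply point_lt_trans; eauto.
    + intros m n; rewrite !HR'; intros [[E _]|K1] [[E' _]|K2]; auto.
      exfalso; now apply (point_lt_irrefl m), (point_lt_trans m n m).
  - intros m n; rewrite !HL', !HR'; intros Hm Hn; unfold point_le.
    destruct (point_lt_total m n Hm Hn) as [K|[->|K]]; auto.
  - apply (Hfun F' 0); auto.
  - apply (Hfun G' 1); auto.
  - intros p Hp; exists (p + p + 0), (p + p + 1).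
    rewrite HF', HG', HR'; repeat split; auto. right.
    destruct (H1 p Hp) as [x [y [Hx [Hy Hxy]]]].
    exists p, 0, x, p, 1, y; repeat split; auto.
    (* For a degenerate interval, [x = y], the sides decide: 0 comes before 1. *)
    pose proof (lt_0_1 HM w); unfold lex.
    destruct (classic (x = y)); [right|left]; auto.
  - intros p q Hp Hq; eapply iff_trans; [exact (H2 p q Hp Hq)|]; split.
    + intros [x [y [Hx [Hy Hxy]]]]; exists (p + p + 1), (q + q + 0).
      rewrite HF', HG', HR'; repeat split; auto.
      * right; exists p, 1, x, q, 0, y; repeat split; auto. left; exact Hxy.
      * intros E; apply (half_inj HM w) in E; auto; destruct E as [_ E]; auto.
    + intros [m [n [Hm [Hn [Hmn N]]]]].
      apply HG' in Hm; apply HF' in Hn; apply HR' in Hmn.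
      destruct Hm as [_ ->], Hn as [_ ->], Hmn as [[E _]|Hmn]; [contradiction|].
      destruct (point_exists p 1 Hp (or_intror eq_refl)) as [x Hx].
      destruct (point_exists q 0 Hq (or_introl eq_refl)) as [y Hy].
      destruct Hmn as [p' [i [x' [q' [j [y' [Hx' [Hy' H]]]]]]]].
      destruct (point_unique _ _ _ _ _ _ _ Hx Hx') as [<- [<- <-]].
      destruct (point_unique _ _ _ _ _ _ _ Hy Hy') as [<- [<- <-]].
      exists x, y.
      destruct Hx as [_ [_ [[E _]|[_ Hx]]]]; [contradiction|].
      destruct Hy as [_ [_ [[_ Hy]|[E _]]]]; [|now symmetry in E].
      (* A right endpoint precedes a left one only if their values are strictly ordered: a tie would
         require 1 < 0 or 1 = 0. *)
      repeat split; auto; destruct H as [[H H']|[_ [H|[E _]]]]; auto.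
      all: first [contradiction | now apply (not_lt0 HM w) in H].
  - intros i j p q Hp Hq Hpq.
    exists (p + p + if i then 1 else 0), (q + q + if j then 1 else 0).
    repeat split.
    + destruct i; [apply HG'|apply HF']; auto.
    + destruct j; [apply HG'|apply HF']; auto.
    + intros E; apply (half_inj HM w) in E; [|destruct i; auto|destruct j; auto].
      destruct E as [-> E], Hpq as [N|N]; [auto|].
      destruct i, j; auto.
Qed.

End Distinguishing.

Theorem theorem4p1 : provable RCA0 closed_implies_distinguishing.
Proof.
  apply completeness; intros M HM v w P S.
  unfold closed_interval_order, distinguishing_interval_order.
  rewrite sat_imp, !sat_and, !sat_partial_order; intros [HP H]; split; [exact HP|].
  rewrite sat_exS in H; destruct H as [L H].
  rewrite sat_exS in H; destruct H as [R H].
  rewrite sat_exS in H; destruct H as [F H].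
  rewrite sat_exS in H; destruct H as [G H].
  apply sat_interval_rep in H; cbn in H.
  destruct (distinguishing_rep HM P S L R F G H) as [L' [R' [F' [G' [H1 H2]]]]].
  apply sat_exS; exists L'. apply sat_exS; exists R'.
  apply sat_exS; exists F'. apply sat_exS; exists G'.
  apply sat_and; split; [now apply sat_interval_rep|].
  apply sat_c4; [|exact H2].
  intros E; apply (succ_neq0 HM w zero); rewrite (add0x HM w); auto.
Qed.
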